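(* Let $d,K,J\ge 1$ be integers, let $\kappa_y,\kappa_\Psi,\kappa_h>0$ and $\ell_h\in[0,\infty)$, and let $\Sigma\in\mathbb R^{d\times d}$, $\Gamma\in\mathbb R^{K\times K}$ be symmetric positive definite. For every $R\ge1$ there exists a constant $L_{\mathsf T}=L_{\mathsf T}(R,\kappa_y,\kappa_\Psi,\kappa_h,\ell_h,\Sigma,\Gamma)$ such that, whenever $y_1^\dagger,\dots,y_J^\dagger\in\mathbb R^K$ satisfy $\max_{1\le j\le J}|y_j^\dagger|\le\kappa_y$, $\Psi\colon\mathbb R^d\to\mathbb R^d$ is Borel measurable with $|\Psi|\le\kappa_\Psi$ everywhere, and $h\colon\mathbb R^d\to\mathbb R^K$ is continuous with $|h|\le\kappa_h$ everywhere and Lipschitz constant at most $\ell_h$, one has for all $\pi\in\mathcal P_R(\mathbb R^d\times\mathbb R^K)$, all probability measures $\mu$ on $\mathbb R^d$ and all $j\in\{0,\dots,J-1\}$ $$d_g(\mathsf T_j\pi,\mathsf T_jp)\le L_{\mathsf T}\,d_g(\pi,p),\qquad p:=\mathsf Q\mathsf P\mu .$$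
   Context: Notation: $|\cdot|$ is the Euclidean norm and, for $S$ symmetric positive definite, $|v|_S=|S^{-1/2}v|$. $\mathcal P^2(\mathbb R^n)$ is the set of Borel probability measures on $\mathbb R^n$ with finite second moment; $\mathcal M(\mu)$ and $\mathcal C(\mu)$ are the mean and covariance of $\mu$. $\mathcal P_R(\mathbb R^n)$ is the set of probability measures on $\mathbb R^n$ with $|\mathcal M(\mu)|\le R$ and $R^{-2}I_n\preccurlyeq\mathcal C(\mu)\preccurlyeq R^2I_n$ (Loewner order). For $\pi$ on $\mathbb R^d\times\mathbb R^K$ (variables $(u,y)$), $\mathcal C^{uy}(\pi)\in\mathbb R^{d\times K}$ and $\mathcal C^{yy}(\pi)\in\mathbb R^{K\times K}$ denote blocks of $\mathcal C(\pi)$. With $g(v)=1+|v|^2$ on $\mathbb R^n$, $d_g(\mu_1,\mu_2)=\sup_{|f|\le g}\left|\int f\,d\mu_1-\int f\,d\mu_2\right|$ for $\mu_1,\mu_2\in\mathcal P^2(\mathbb R^n)$, the supremum being over measurable $f$ with $|f|\le g$ pointwise. Operators (measures and densities denoted by the same symbol): - $\mathsf P\mu(u)=\frac{1}{\sqrt{(2\pi)^d\det\Sigma}}\int_{\mathbb R^d}\exp\left(-\tfrac12|u-\Psi(v)|_\Sigma^2\right)\mu(dv)$. - $\mathsf Q\mu(u,y)=\frac{1}{\sqrt{(2\pi)^K\det\Gamma}}\exp\left(-\tfrac12|y-h(u)|_\Gamma^2\right)\mu(u)$, a measure on $\mathbb R^d\times\mathbb R^K$. - For $\pi\in\mathcal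 P^2(\mathbb R^d\times\mathbb R^K)$ with $\mathcal C^{yy}(\pi)$ positive definite, $\mathsf T_j\pi$ is the pushforward of $\pi$ under $(u,y)\mapsto u+\mathcal C^{uy}(\pi)\mathcal C^{yy}(\pi)^{-1}(y_{j+1}^\dagger-y)$. *)

(* Defs.v *)
(* MathComp-Analysis: R is an arbitrary realType. *)
From HB Require Import structures.
From mathcomp Require Import all_boot all_order all_algebra.
From mathcomp Require Import all_classical all_reals all_analysis.

Set Implicit Arguments.
Unset Strict Implicit.
Unset Printing Implicit Defensive.

Import Order.TTheory GRing.Theory Num.Theory.
Import numFieldNormedType.Exports.

Local Open Scope classical_set_scope.
Local Open Scope ring_scope.

(* R^n is 'cV[R]_n, with the Borel sigma-algebra of its (library) topology.
   R^d x R^K is 'cV[R]_(d + K), a pair (u, y) being col_mx u y. *)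
Definition borel_mx (R : realType) (m n : nat) :=
  g_sigma_algebraType (@open 'M[R]_(m, n)).

HB.instance Definition _ (R : realType) (m n : nat) :=
  @isMeasurable.Build (sigma_display (@open 'M[R]_(m, n))) 'M[R]_(m, n)
    (@measurable _ (borel_mx R m n)) measurable0
    (@measurableC _ (borel_mx R m n))
    (@bigcupT_measurable _ (borel_mx R m n)).

(* Lebesgue measure on R^n as an iterated product; R^n.+1 is identified with
   R x R^n through the first coordinate. *)
Fixpoint lebesgue_cV (R : realType) (n : nat) : set 'cV[R]_n -> \bar R :=
  match n return set 'cV[R]_n -> \bar R with
  | 0 => \d_(0 : 'cV[R]_0)
  | k.+1 => pushforward
      (product_measure1 (@lebesgue_measure R) (@lebesgue_cV R k))
      (fun z : measurableTypeR R * 'cV[R]_k =>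
         col_mx (z.1 : R)%:M z.2 : 'cV[R]_(1 + k))
  end.

Arguments lebesgue_cV : clear implicits.

Section definitions.
Context {R : realType}.

(* Not `|v|, which is the sup norm on matrices. *)
Definition enorm n (v : 'cV[R]_n) : R := Num.sqrt (\sum_i v i 0 ^+ 2).

Definition qform n (S : 'M[R]_n) (v : 'cV[R]_n) : R := (v^T *m S *m v) 0 0.

Definition psdmx n (S : 'M[R]_n) : Prop :=
  S^T = S /\ forall v, 0 <= qform S v.

Definition spdmx n (S : 'M[R]_n) : Prop :=
  S^T = S /\ forall v, v != 0 -> 0 < qform S v.

Definition loewner_le n (A B : 'M[R]_n) : Prop := psdmx (B - A).

(* S^{1/2}: the positive semidefinite square root, which exists and is unique
   when S is positive semidefinite; 0 is a junk value otherwise. *)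
Definition sqrtmx n (S : 'M[R]_n) : 'M[R]_n :=
  xget 0 [set B | psdmx B /\ B *m B = S].

Definition wnorm n (S : 'M[R]_n) (v : 'cV[R]_n) : R :=
  enorm (invmx (sqrtmx S) *m v).

(* Operations on measures are defined on arbitrary set functions, as the
   library does for integral and pushforward. *)

Definition second_moment n (mu : set 'cV[R]_n -> \bar R) : \bar R :=
  (\int[mu]_x (enorm x ^+ 2)%:E)%E.

Definition mean n (mu : set 'cV[R]_n -> \bar R) : 'cV[R]_n :=
  \col_i fine (\int[mu]_x (x i 0)%:E)%E.

Definition cov n (mu : set 'cV[R]_n -> \bar R) : 'M[R]_n :=
  \matrix_(i, j)
    fine (\int[mu]_x ((x i 0 - mean mu i 0) * (x j 0 - mean mu j 0))%:E)%E.

Definition cov_uy d K (mu : set 'cV[R]_(d + K) -> \bar R) : 'M[R]_(d, K) :=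
  ursubmx (cov mu).

Definition cov_yy d K (mu : set 'cV[R]_(d + K) -> \bar R) : 'M[R]_K :=
  drsubmx (cov mu).

(* The finite second moment is what makes mean and cov meaningful. *)
Definition in_PR n (r : R) (mu : probability 'cV[R]_n R) : Prop :=
  [/\ (second_moment mu < +oo)%E,
      enorm (mean mu) <= r,
      loewner_le (r ^- 2)%:M (cov mu) &
      loewner_le (cov mu) (r ^+ 2)%:M].

Definition g_weight n (v : 'cV[R]_n) : R := 1 + enorm v ^+ 2.

Definition dg n (mu1 mu2 : set 'cV[R]_n -> \bar R) : \bar R :=
  ereal_sup
    [set `| \int[mu1]_x (f x)%:E - \int[mu2]_x (f x)%:E |%E | f in
       [set f : 'cV[R]_n -> R | measurable_fun [set: 'cV[R]_n] f /\
                                forall v, `|f v| <= g_weight v]].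

Definition gauss_const n (S : 'M[R]_n) : R :=
  (Num.sqrt ((2 * pi) ^+ n * \det S))^-1.

Definition P_density d (Sigma : 'M[R]_d) (Psi : 'cV[R]_d -> 'cV[R]_d)
    (mu : set 'cV[R]_d -> \bar R) (u : 'cV[R]_d) : \bar R :=
  ((gauss_const Sigma)%:E *
   \int[mu]_v (expR (- 2^-1 * wnorm Sigma (u - Psi v) ^+ 2))%:E)%E.

Definition P_op d (Sigma : 'M[R]_d) (Psi : 'cV[R]_d -> 'cV[R]_d)
    (mu : set 'cV[R]_d -> \bar R) : set 'cV[R]_d -> \bar R :=
  fun A => (\int[lebesgue_cV R d]_(u in A) P_density Sigma Psi mu u)%E.

(* mu(du) times a Lebesgue density in y. *)
Definition Q_op d K (Gamma : 'M[R]_K) (h : 'cV[R]_d -> 'cV[R]_K)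
    (mu : set 'cV[R]_d -> \bar R) : set 'cV[R]_(d + K) -> \bar R :=
  fun C =>
    (\int[mu]_u \int[lebesgue_cV R K]_(y in [set y | C (col_mx u y)])
       (gauss_const Gamma *
        expR (- 2^-1 * wnorm Gamma (y - h u) ^+ 2))%:E)%E.

(* invmx is total: it is the inverse when cov_yy pi is positive definite. *)
Definition T_op d K (ydag : 'cV[R]_K) (pi : set 'cV[R]_(d + K) -> \bar R) :
    set 'cV[R]_d -> \bar R :=
  pushforward pi (fun z : 'cV[R]_(d + K) =>
    usubmx z + cov_uy pi *m invmx (cov_yy pi) *m (ydag - dsubmx z)).

End definitions.

(* Main.v *)
Require Import Defs.
From HB Require Import structures.
From mathcomp Require Import all_boot all_order all_algebra.
From mathcomp Require Import all_classical all_reals all_analysis.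
From mathcomp Require Import measurable_realfun ring lra.
From mathcomp.real_closed Require Import complex.

Set Implicit Arguments.
Unset Strict Implicit.
Unset Printing Implicit Defensive.

Import Order.TTheory GRing.Theory Num.Theory.
Import numFieldNormedType.Exports.

Local Open Scope classical_set_scope.
Local Open Scope ring_scope.

(** Write [p] for the joint law [Q P mu], [T pi] for the affine map
    [(u, y) |-> u + A (ydag - y)] with gain [A = Cuy Cyy^-1] computed from [pi], and
    split
      [ |pi (f o T pi) - p (f o T p)|
          <= |(pi - p) (f o T pi)| + |p (f o T pi - f o T p)|. ]

    In the first term [f o T pi] is at most a constant times the weight
    [1 + |x|^2], because the gain is bounded, so the term is at most a constant
    times [dg pi p] by definition of the distance.

    In the second term [f] is only measurable, so the difference of the two maps
    has to be absorbed by [p].  Now [p] has a density [rho (u, y)], and for fixed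
    [y] the substitution [u + A (ydag - y) |-> u] turns the term into
      [ int f(u) (rho (u - A b, y) - rho (u - A' b, y)) du dy,  b = ydag - y, ]
    where [A'] is the gain computed from [p].  The density is Lipschitz in [u] with
    a Gaussian-decaying constant, and all polynomial moments of a Gaussian are
    finite, so the second term is at most a constant times [|A - A'|]
    ([integral_affine_map_diff]).  The Lipschitz property
    ([joint_density_bounds]) comes from the boundedness of [Psi] and [h] and from
    the Lipschitz bound on [h]: the integrand is [exp (- s^2 / 2)], where [s] is the
    Euclidean norm of a residual that is Lipschitz in [u], and
    [exp (- s^2 / 2)] is Lipschitz in [s] with a constant that decays like
    [exp (- s^2 / 4)].

    It remains to bound [|A - A'|] by a constant times [dg pi p].  First and second
    moments are integrals of functions dominated by the weight, so the entries of
    the covariances differ by at most a constant times [dg pi p] ([cov_stable]).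
    The block [Cyy] is bounded below for [pi] by assumption, and for [p] because
    [rho] is bounded below by a Gaussian ([cov_yy_density_coercive]).  The resolvent
    identity then gives the bound on the gains ([mxl1_gainB]).

    All of this rests on bounding [rho] between multiples of Gaussians and on its
    Lipschitz bound, uniformly in [Psi], [h] and [mu]; [dg_T_op_regular_density] is
    the estimate for an arbitrary [p] with such a density, a finite measure whose
    mass differs from [1] by at most [dg pi p]. *)

(** * Positive square roots of positive definite matrices *)

Lemma eq_horner_mx_diagonalized (F : fieldType) n (P A : 'M[F]_n.+1)
    (d : 'rV[F]_n.+1) (p q : {poly F}) :
  P \in unitmx -> A = invmx P *m diag_mx d *m P ->
  (forall i, p.[d 0 i] = q.[d 0 i]) -> horner_mx A p = horner_mx A q.
Proof.
move=> Pu -> pq; rewrite !horner_mx_uconjC// !horner_mx_diag.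
suff -> : map_mx (horner p) d = map_mx (horner q) d by [].
by apply/rowP => i; rewrite !mxE.
Qed.

Section SquareRoot.
Variable R : realType.

Lemma poly_interpolation (s : seq R) (f : R -> R) :
  exists p : {poly R}, forall x, x \in s -> p.[x] = f x.
Proof.
elim: s => [|x s [p hp]]; first by exists 0.
case: (boolP (x \in s)) => xs.
  by exists p => y; rewrite inE => /predU1P[->|]; exact: hp.
pose w := \prod_(t <- s) ('X - t%:P).
have wx : w.[x] != 0 by rewrite -[_ == 0]/(root w x) root_prod_XsubC.
exists (p + ((f x - p.[x]) / w.[x])%:P * w) => y.
rewrite inE !hornerE => /predU1P[->|ys]; first by rewrite divfK// subrKC.
have /eqP-> : w.[y] == 0 by rewrite -[_ == 0]/(root w y) root_prod_XsubC.
by rewrite mulr0 addr0 hp.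
Qed.

Lemma horner_mx_tr n (A : 'M[R]_n.+1) (p : {poly R}) :
  (horner_mx A p)^T = horner_mx A^T p.
Proof.
elim/poly_ind: p => [|p c ih]; first by rewrite !rmorph0 trmx0.
rewrite !rmorphD !rmorphM /= !horner_mx_X !horner_mx_C linearD /= tr_scalar_mx.
congr (_ + _); rewrite trmx_mul ih.
exact: comm_mx_horner (comm_mx_refl _).
Qed.

Lemma qform_eigen n (S : 'M[R]_n) (v : 'rV[R]_n) a :
  v *m S = a *: v -> qform S v^T = a * (v *m v^T) 0 0.
Proof. by move=> e; rewrite /qform trmxK e -scalemxAl mxE. Qed.

Lemma mulmx_tr_ge0 n (v : 'rV[R]_n) : 0 <= (v *m v^T) 0 0.
Proof. by rewrite mxE sumr_ge0// => i _; rewrite mxE -expr2 sqr_ge0. Qed.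

(** Over the complex numbers [S] is unitarily diagonalisable with real eigenvalues,
    which are nonnegative because they are also eigenvalues of the real matrix [S].  A real polynomial in [S] is then determined
    by its values at the eigenvalues, and it is a real matrix by construction. *)
Lemma spdmx_functional_calculus n (S : 'M[R]_n.+1) : spdmx S ->
  exists l : 'rV[R]_n.+1, (forall i, 0 <= l 0 i) /\
    forall p q : {poly R}, (forall i, p.[l 0 i] = q.[l 0 i]) ->
    horner_mx S p = horner_mx S q.
Proof.
move=> [symS posS].
pose f := complex.real_complex R.
pose SC : 'M[complex.complex R]_n.+1 := map_mx f S.
have hS : SC \is hermsymmx.
  apply: realsym_hermsym.
    by apply/is_hermitianmxP; rewrite expr0 scale1r map_mx_id// map_trmx symS.
  by apply/mxOverP => i j; rewrite mxE; apply/complex.complex_realP; exists (S i j).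
have /orthomx_spectralP eS := hermitian_normalmx hS.
have /mxOverP spreal := hermitian_spectral_diag_real hS.
set P := spectralmx SC in eS; set sp := spectral_diag SC in eS spreal.
have Pu : P \in unitmx by exact: spectral_unit.
have [l spE] : exists l : 'rV[R]_n.+1, sp = map_mx f l.
  exists (\row_i complex.Re (sp 0 i)).
  by apply/rowP => i; rewrite !mxE [RHS]complex.RRe_real.
exists l; split=> [i|p q pq].
  have : eigenvalue SC (sp 0 i).
    apply/eigenvalueP; exists (row i P).
      rewrite -row_mul {1}eS !mulmxA mulmxV// mul1mx row_mul row_diag_mx -scalemxAl.
      by rewrite rowE.
    by apply: contraTneq Pu => ri0; rewrite -row_free_unit; apply/row_freePn;
       exists i; rewrite ri0 sub0mx.
  rewrite spE mxE eigenvalue_map => /eigenvalueP[v ve v0].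
  have vT0 : v^T != 0 by rewrite -trmx0 (inj_eq trmx_inj).
  have := posS _ vT0; rewrite (qform_eigen ve).
  have vv : 0 < (v *m v^T) 0 0.
    rewrite lt_neqAle mulmx_tr_ge0 andbT eq_sym; apply/negP => /eqP h0.
    by have := posS _ vT0; rewrite (qform_eigen ve) h0 mulr0 ltxx.
  by rewrite pmulr_lgt0// => /ltW.
apply: (@map_mx_inj _ _ f); rewrite !map_horner_mx -/SC.
apply: (eq_horner_mx_diagonalized Pu eS) => i.
by rewrite spE mxE !(horner_map f) pq.
Qed.

(** The square root is a polynomial [p] in [S], with [p] interpolating the square
    root at the eigenvalues.  Interpolating the fourth root by [q] shows that it is
    positive, since [p(S) = q(S)^T q(S)]. *)
Lemma spdmx_sqrt_exists n (S : 'M[R]_n) : spdmx S ->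
  exists B, psdmx B /\ B *m B = S.
Proof.
case: n S => [S _|n S hS].
  exists S; split; last by apply/matrixP => -[].
  by split=> [|v]; [apply/matrixP => -[]|rewrite /qform mxE big_ord0].
have [l [l0 hl]] := spdmx_functional_calculus hS.
have [p hp] := poly_interpolation [seq l 0 i | i : 'I_n.+1] (@Num.sqrt R).
have [q hq] := poly_interpolation [seq l 0 i | i : 'I_n.+1]
  (fun x => Num.sqrt (Num.sqrt x)).
have lmem i : l 0 i \in [seq l 0 i | i : 'I_n.+1] by apply: codom_f.
have symq : (horner_mx S q)^T = horner_mx S q by rewrite horner_mx_tr hS.1.
have pE : horner_mx S p = horner_mx S q *m horner_mx S q.
  rewrite -[RHS]/(horner_mx S q * _) -rmorphM; apply: hl => i.
  by rewrite hornerM hq// hp// -expr2 sqr_sqrtr// sqrtr_ge0.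
exists (horner_mx S p); split; last first.
  rewrite -[LHS]/(horner_mx S p * _) -rmorphM -[RHS]horner_mx_X; apply: hl => i.
  by rewrite hornerM hp// -expr2 sqr_sqrtr// hornerX.
split=> [|v]; first by rewrite horner_mx_tr hS.1.
rewrite /qform pE -{1}symq mulmxA -mulmxA -trmx_mul.
by rewrite -[X in _ *m X]trmxK mulmx_tr_ge0.
Qed.

Lemma sqrtmx_unit n (S : 'M[R]_n) : spdmx S -> sqrtmx S \in unitmx.
Proof.
move=> hS; rewrite -row_free_unit -kermx_eq0; apply/rowV0P => v /sub_kermxP vB.
have [B hB] := spdmx_sqrt_exists hS.
have [_ BB] : psdmx (sqrtmx S) /\ sqrtmx S *m sqrtmx S = S.
  by rewrite /sqrtmx; case: xgetP => [_ -> //|/(_ B hB)].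
apply/eqP/negPn/negP => v0; have vT0 : v^T != 0 by rewrite -trmx0 (inj_eq trmx_inj).
by have := hS.2 _ vT0; rewrite /qform trmxK -BB mulmxA vB !mul0mx mxE ltxx.
Qed.

End SquareRoot.

(** * Euclidean norm, entrywise matrix norm and the Kalman gain *)

Section EuclideanNorm.
Variable R : realType.

Lemma enorm_ge0 n (v : 'cV[R]_n) : 0 <= enorm v.
Proof. exact: sqrtr_ge0. Qed.

Lemma enorm_sqr n (v : 'cV[R]_n) : enorm v ^+ 2 = \sum_i v i 0 ^+ 2.
Proof. by rewrite sqr_sqrtr// sumr_ge0// => i _; exact: sqr_ge0. Qed.

Lemma enormN n (v : 'cV[R]_n) : enorm (- v) = enorm v.
Proof. by congr Num.sqrt; apply: eq_bigr => i _; rewrite mxE sqrrN. Qed.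

Lemma sqr_coord_le n (v : 'cV[R]_n) i : v i 0 ^+ 2 <= enorm v ^+ 2.
Proof.
by rewrite enorm_sqr (bigD1 i)//= lerDl sumr_ge0// => j _; exact: sqr_ge0.
Qed.

Lemma coord_le_enorm n (v : 'cV[R]_n) i : `|v i 0| <= enorm v.
Proof.
by rewrite -ler_sqr ?nnegrE ?enorm_ge0// real_normK ?num_real// sqr_coord_le.
Qed.

Lemma enorm_le_sum n (v : 'cV[R]_n) : enorm v <= \sum_i `|v i 0|.
Proof.
have s0 : 0 <= \sum_i `|v i 0| by exact: sumr_ge0.
rewrite -ler_sqr ?nnegrE ?enorm_ge0// enorm_sqr [leRHS]expr2 mulr_suml.
apply: ler_sum => i _; rewrite -real_normK ?num_real// expr2 ler_wpM2l//.
by rewrite (bigD1 i)//= lerDl sumr_ge0.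
Qed.

Lemma cauchy_schwarz n (u v : 'cV[R]_n) :
  `|\sum_i u i 0 * v i 0| <= enorm u * enorm v.
Proof.
have key (w : 'cV[R]_n) : \sum_i w i 0 * v i 0 <= enorm w * enorm v.
  have [w0|w0] := eqVneq (enorm w) 0.
    rewrite w0 mul0r big1// => i _; suff -> : w i 0 = 0 by rewrite mul0r.
    by apply/normr0_eq0/eqP; rewrite eq_le normr_ge0 -w0 coord_le_enorm.
  have [v0|v0] := eqVneq (enorm v) 0.
    rewrite v0 mulr0 big1// => i _; suff -> : v i 0 = 0 by rewrite mulr0.
    by apply/normr0_eq0/eqP; rewrite eq_le normr_ge0 -v0 coord_le_enorm.
  have : 0 <= \sum_i (enorm v * w i 0 - enorm w * v i 0) ^+ 2.
    by apply: sumr_ge0 => i _; exact: sqr_ge0.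
  have -> : \sum_i (enorm v * w i 0 - enorm w * v i 0) ^+ 2 =
    enorm v ^+ 2 * (\sum_i w i 0 ^+ 2) + enorm w ^+ 2 * (\sum_i v i 0 ^+ 2)
    - 2 * enorm v * enorm w * \sum_i w i 0 * v i 0.
    rewrite !mulr_sumr -big_split/= -sumrB; apply: eq_bigr => i _; ring.
  rewrite -!enorm_sqr.
  have -> (x y s : R) : x ^+ 2 * y ^+ 2 + y ^+ 2 * x ^+ 2 - 2 * x * y * s =
    (2 * x * y) * (y * x - s) by ring.
  rewrite pmulr_rge0 ?subr_ge0// !mulr_gt0//.
    by rewrite lt_neqAle eq_sym v0 enorm_ge0.
  by rewrite lt_neqAle eq_sym w0 enorm_ge0.
rewrite ler_norml key andbT lerNl -sumrN -(enormN u).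
by apply: le_trans (key (- u)); apply: ler_sum => i _; rewrite mxE mulNr.
Qed.

Lemma enormD n (u v : 'cV[R]_n) : enorm (u + v) <= enorm u + enorm v.
Proof.
rewrite -ler_sqr ?nnegrE ?addr_ge0 ?enorm_ge0//.
have -> : enorm (u + v) ^+ 2 =
    enorm u ^+ 2 + 2 * (\sum_i u i 0 * v i 0) + enorm v ^+ 2.
  rewrite !enorm_sqr mulr_sumr -!big_split/=; apply: eq_bigr => i _.
  rewrite mxE; ring.
have := le_trans (ler_norm _) (cauchy_schwarz u v).
by rewrite sqrrD -mulr_natl; lra.
Qed.

Lemma enormB n (u v : 'cV[R]_n) : enorm (u - v) <= enorm u + enorm v.
Proof. by rewrite -(enormN v) enormD. Qed.

Lemma enorm_sqrD n (u v : 'cV[R]_n) :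
  enorm (u + v) ^+ 2 <= 2 * enorm u ^+ 2 + 2 * enorm v ^+ 2.
Proof.
have := sqr_ge0 (enorm u - enorm v); have := enormD u v.
have := enorm_ge0 (u + v); nra.
Qed.

Lemma enorm_sqrB n (u v : 'cV[R]_n) :
  enorm (u - v) ^+ 2 <= 2 * enorm u ^+ 2 + 2 * enorm v ^+ 2.
Proof. by rewrite -(enormN v) enorm_sqrD. Qed.

Lemma enorm_col_mx m n (u : 'cV[R]_m) (v : 'cV[R]_n) :
  enorm (col_mx u v) ^+ 2 = enorm u ^+ 2 + enorm v ^+ 2.
Proof.
rewrite !enorm_sqr big_split_ord/=.
by congr (_ + _); apply: eq_bigr => i _; rewrite (col_mxEu, col_mxEd).
Qed.

Lemma enorm_usubmx m n (z : 'cV[R]_(m + n)) :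
  enorm z ^+ 2 = enorm (usubmx z) ^+ 2 + enorm (dsubmx z) ^+ 2.
Proof. by rewrite -enorm_col_mx vsubmxK. Qed.

(** The sum of the absolute values of the entries: it dominates the operator norm,
    is submultiplicative, and can be estimated entry by entry. *)
Definition mxl1 m n (A : 'M[R]_(m, n)) : R := \sum_i \sum_j `|A i j|.

Lemma mxl1_ge0 m n (A : 'M[R]_(m, n)) : 0 <= mxl1 A.
Proof. by apply: sumr_ge0 => i _; exact: sumr_ge0. Qed.

Lemma mxl1D m n (A B : 'M[R]_(m, n)) : mxl1 (A + B) <= mxl1 A + mxl1 B.
Proof.
rewrite /mxl1 -big_split; apply: ler_sum => i _.
rewrite -big_split; apply: ler_sum => j _; rewrite mxE; exact: ler_normD.
Qed.

Lemma mxl1M m n p (A : 'M[R]_(m, n)) (B : 'M[R]_(n, p)) :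
  mxl1 (A *m B) <= mxl1 A * mxl1 B.
Proof.
rewrite /mxl1 mulr_suml; apply: ler_sum => i _.
apply: (@le_trans _ _ (\sum_j \sum_k `|A i k| * `|B k j|)).
  apply: ler_sum => j _; rewrite mxE; apply: le_trans (ler_norm_sum _ _ _) _.
  by apply: ler_sum => k _; rewrite normrM.
rewrite exchange_big mulr_suml; apply: ler_sum => k _ /=.
rewrite -mulr_sumr ler_wpM2l// (bigD1 k)//= lerDl.
by apply: sumr_ge0 => l _; exact: sumr_ge0.
Qed.

Lemma enorm_mulmx m n (A : 'M[R]_(m, n)) (v : 'cV[R]_n) :
  enorm (A *m v) <= mxl1 A * enorm v.
Proof.
apply: le_trans (enorm_le_sum _) _; rewrite mulr_suml; apply: ler_sum => i _.
rewrite mxE mulr_suml; apply: le_trans (ler_norm_sum _ _ _) _.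
by apply: ler_sum => j _; rewrite normrM ler_wpM2l// coord_le_enorm.
Qed.

Lemma mxl1_entries m n (A : 'M[R]_(m, n)) e :
  (forall i j, `|A i j| <= e) -> mxl1 A <= m%:R * n%:R * e.
Proof.
move=> Ae; apply: (@le_trans _ _ (\sum_(i < m) \sum_(j < n) e)).
  by apply: ler_sum => i _; apply: ler_sum => j _.
by rewrite !sumr_const !card_ord -mulrnA mulnC -natrM mulr_natl.
Qed.

Lemma qformE n (S : 'M[R]_n) v : qform S v = \sum_i v i 0 * (S *m v) i 0.
Proof. by rewrite /qform -mulmxA mxE; apply: eq_bigr => i _; rewrite mxE. Qed.

Definition coercive n (c : R) (S : 'M[R]_n) : Prop :=
  forall v, c * enorm v ^+ 2 <= qform S v.

Lemma coercive_lower n c (S : 'M[R]_n) v : coercive c S ->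
  c * enorm v <= enorm (S *m v).
Proof.
move=> Sc; have [v0|v0] := eqVneq (enorm v) 0.
  by rewrite v0 mulr0 enorm_ge0.
have vp : 0 < enorm v by rewrite lt_neqAle eq_sym v0 enorm_ge0.
rewrite -(ler_pM2l vp); apply: le_trans (le_trans (Sc v) _).
  by rewrite expr2 mulrCA.
rewrite qformE; exact: le_trans (ler_norm _) (cauchy_schwarz _ _).
Qed.

Lemma enorm_eq0 n (v : 'cV[R]_n) : enorm v = 0 -> v = 0.
Proof.
move=> v0; apply/matrixP => i j; rewrite ord1 mxE.
by apply/normr0_eq0/eqP; rewrite eq_le normr_ge0 -v0 coord_le_enorm.
Qed.

Lemma coercive_unit n c (S : 'M[R]_n) : 0 < c -> coercive c S -> S \in unitmx.
Proof.
move=> c0 Sc; rewrite -unitmx_tr -row_free_unit -kermx_eq0.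
apply/rowV0P => v /sub_kermxP vS.
have Sv : S *m v^T = 0 by rewrite -[S]trmxK -trmx_mul vS trmx0.
have := coercive_lower v^T Sc; rewrite Sv.
have -> : enorm (0 : 'cV[R]_n) = 0.
  by rewrite /enorm big1 ?sqrtr0// => i _; rewrite mxE expr0n.
rewrite pmulr_rle0// => v0; apply: trmx_inj; rewrite trmx0.
by apply: enorm_eq0; apply/eqP; rewrite eq_le v0 enorm_ge0.
Qed.

(** Coercivity gives [c |v| <= |S v|]; applied to the columns of the inverse this
    bounds every entry of the inverse by [1 / c]. *)
Lemma coercive_invmx n c (S : 'M[R]_n) : 0 < c -> coercive c S ->
  mxl1 (invmx S) <= n%:R * n%:R * c^-1.
Proof.
move=> c0 Sc; apply: mxl1_entries => i j.
have Su := coercive_unit c0 Sc.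
have := coercive_lower (invmx S *m delta_mx j 0) Sc.
rewrite mulKVmx//.
have -> : enorm (delta_mx j 0 : 'cV[R]_n) = 1.
  rewrite /enorm (bigD1 j)//= big1 ?mxE ?eqxx ?expr1n ?addr0 ?sqrtr1// => k kj.
  by rewrite mxE (negbTE kj) expr0n.
move=> h; rewrite -(ler_pM2l c0 _ c^-1) divff ?gt_eqF//.
apply: le_trans h; rewrite ler_pM2l//.
by apply: le_trans (coord_le_enorm _ i); rewrite -colE mxE.
Qed.

(** The Kalman gain [Cuy Cyy^-1] of a block covariance matrix. *)
Definition gain d K (C : 'M[R]_(d + K)) : 'M[R]_(d, K) :=
  ursubmx C *m invmx (drsubmx C).

Lemma mxl1_gain d K c M (C : 'M[R]_(d + K)) : 0 < c ->
  coercive c (drsubmx C) -> (forall i j, `|C i j| <= M) ->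
  mxl1 (gain C) <= (d%:R * K%:R * M) * (K%:R * K%:R * c^-1).
Proof.
move=> c0 Cc CM; apply: le_trans (mxl1M _ _) _.
apply: ler_pM; rewrite ?mxl1_ge0//; last exact: coercive_invmx.
by apply: mxl1_entries => i j; rewrite mxE mxE.
Qed.

(** Resolvent identity: [A - A'] splits into a difference of the off-diagonal
    blocks and [A' (C'yy - Cyy) Cyy^-1]. *)
Lemma mxl1_gainB d K c M e (C C' : 'M[R]_(d + K)) : 0 < c ->
  coercive c (drsubmx C) -> coercive c (drsubmx C') ->
  (forall i j, `|C' i j| <= M) -> (forall i j, `|C i j - C' i j| <= e) ->
  mxl1 (gain C - gain C') <=
  (d%:R * K%:R + (d%:R * K%:R * M) * (K%:R * K%:R * c^-1) * (K%:R * K%:R))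
    * (K%:R * K%:R * c^-1) * e.
Proof.
move=> c0 Cc C'c C'M Ce.
have Cu := coercive_unit c0 Cc; have C'u := coercive_unit c0 C'c.
have -> : gain C - gain C' = ((ursubmx C - ursubmx C') +
    gain C' *m (drsubmx C' - drsubmx C)) *m invmx (drsubmx C).
  rewrite /gain mulmxDl mulmxBl mulmxBr mulmxBl.
  by rewrite mulmxKV// mulmxK// addrA subrK.
have iC := coercive_invmx c0 Cc.
have gC' := mxl1_gain c0 C'c C'M.
have d1 : mxl1 (ursubmx C - ursubmx C') <= d%:R * K%:R * e.
  by apply: mxl1_entries => i j; rewrite !mxE.
have d2 : mxl1 (drsubmx C' - drsubmx C) <= K%:R * K%:R * e.
  by apply: mxl1_entries => i j; rewrite !mxE distrC.
apply: le_trans (mxl1M _ _) _.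
rewrite [leRHS]mulrAC; apply: ler_pM; rewrite ?mxl1_ge0//.
apply: le_trans (mxl1D _ _) _; rewrite mulrDl lerD//.
apply: le_trans (mxl1M _ _) _; rewrite -[leRHS]mulrA.
by apply: ler_pM; rewrite ?mxl1_ge0.
Qed.

End EuclideanNorm.

(** * Borel measurability of matrix-valued maps *)

Section MatrixMeasurability.
Variable R : realType.

(** Balls of radius [1 / (k + 1)] around matrices with rational entries form a
    countable basis, so the Borel sets of matrices are generated by boxes. *)
Lemma rational_ball_cover m n (U : set 'M[R]_(m, n)) : open U ->
  U = \bigcup_(qk : 'M[rat]_(m, n) * nat)
    [set v | ball (map_mx ratr qk.1 : 'M[R]_(m, n)) qk.2.+1%:R^-1 `<=` U /\
             forall i j, `|ratr (qk.1 i j) - v i j| < qk.2.+1%:R^-1].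
Proof.
move=> oU; apply/seteqP; split=> [v Uv|v [qk _ /= [sU qv]]]; last first.
  apply: sU; split=> [|i j]; first by rewrite invr_gt0.
  by rewrite mxE; exact: qv.
have /nbhs_ballP[e /= e0 eU] : nbhs v U by exact: open_nbhs_nbhs.
(* Twice the radius has to fit into [e]: the centre is within it of [v]. *)
have [k ke] : exists k : nat, k.+1%:R^-1 < e / 2.
  have e2 : 0 < e / 2 by rewrite divr_gt0.
  have [N _ /(_ N (leqnn N)) H] := near_infty_natSinv_lt (PosNum e2).
  by exists N.
have /choice [q hq] : forall ij : 'I_m * 'I_n, exists q : rat,
    ratr q \in `]v ij.1 ij.2 - k.+1%:R^-1, v ij.1 ij.2 + k.+1%:R^-1[.
  move=> ij; apply: rat_in_itvoo.
  by rewrite ltrBlDr -addrA ltrDl addr_gt0 ?invr_gt0.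
have hqv i j : `|ratr (q (i, j)) - v i j| < k.+1%:R^-1.
  by have := hq (i, j); rewrite in_itv/= ltr_distl.
exists (\matrix_(i, j) q (i, j), k) => //=; split=> [w [_ qw]|i j]; last by rewrite mxE.
apply: eU; split=> // i j.
have := qw i j; rewrite !mxE /ball/= /ball_ => hw.
rewrite -(subrKA (ratr (q (i, j)))) (le_lt_trans (ler_normD _ _))//.
by rewrite [ltRHS]splitr ltrD// (lt_trans _ ke)// distrC.
Qed.

Lemma measurable_mx_coord m n i j :
  measurable_fun setT (fun M : 'M[R]_(m, n) => M i j).
Proof.
apply: (measurability _ (measurable_realfun.RGenOpens.measurableE R)).
move=> _ [_ [a [b ->] <-]]; rewrite setTI; apply: sub_sigma_algebra.
by apply: open_comp => [M _|]; [exact: coord_continuous|exact: interval_open].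
Qed.

(** Preimages of balls are finite intersections of preimages of intervals under the
    coordinates. *)
Lemma measurable_fun_mx d (T : measurableType d) m n (f : T -> 'M[R]_(m, n)) :
  (forall i j, measurable_fun setT (fun t => f t i j)) -> measurable_fun setT f.
Proof.
move=> mf; apply: (@measurability _ _ _ _ _ _ (@open 'M[R]_(m, n))) => //.
move=> _ [U oU <-]; rewrite setTI (rational_ball_cover oU) preimage_bigcup.
apply: countable_bigcupT_measurable => // -[q k].
have [sU|nU] := pselect (ball (map_mx ratr q : 'M[R]_(m, n)) k.+1%:R^-1 `<=` U);
    last first.
  by rewrite [X in measurable X](_ : _ = set0)// -subset0 => t [].
rewrite [X in measurable X](_ : _ = \bigcap_(ij in [set: 'I_m * 'I_n])
    (fun t => f t ij.1 ij.2) @^-1`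
      `](ratr (q ij.1 ij.2) - k.+1%:R^-1), (ratr (q ij.1 ij.2) + k.+1%:R^-1)[).
  apply: fin_bigcap_measurable => [|[i j] _]; first exact: finite_finset.
  by rewrite -[X in measurable X]setTI; apply: mf => //; exact: measurable_itv.
apply/seteqP; split=> [t [_ H] [i j] _|t H]; last split=> // i j.
  by have := H i j; rewrite /= in_itv/= distrC ltr_distl.
by have := H (i, j) I; rewrite /= in_itv/= distrC ltr_distl.
Qed.

End MatrixMeasurability.

(** * Lebesgue measure on column vectors *)

(** The image measure packed as a measure, for rewriting with the bare set
    function [pushforward m f]. *)
Lemma pushforward_is_measure d d' (T1 : measurableType d) (T2 : measurableType d')
    (R : realFieldType) (m : {measure set T1 -> \bar R}) (f : T1 -> T2) :
  measurable_fun setT f ->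
  exists mu : {measure set T2 -> \bar R}, (mu : set _ -> \bar R) = pushforward m f.
Proof.
move=> mf.
exact: ex_intro _
  (measure_function.measure_function_pushforward__canonical__measure_function_Measure
     m mf) erefl.
Qed.

Lemma ge0_integral_image d d' (T1 : measurableType d) (T2 : measurableType d')
    (R : realType) (m1 : {measure set T1 -> \bar R}) (m2 : {measure set T2 -> \bar R})
    (phi : T1 -> T2) (f : T2 -> \bar R) :
  measurable_fun setT phi ->
  (forall A, measurable A -> m2 A = m1 (phi @^-1` A)) ->
  measurable_fun [set: T2] f -> (forall x, 0 <= f x)%E ->
  (\int[m2]_x f x = \int[m1]_x f (phi x))%E.
Proof.
move=> mphi m12 mf f0; have [mu muE] := pushforward_is_measure m1 mphi.
rewrite (eq_measure_integral mu) => [|A mA _]; last by rewrite muE m12.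
by rewrite muE ge0_integral_pushforward// preimage_setT.
Qed.

Section LebesgueVectors.
Variable R : realType.
Local Open Scope ereal_scope.

Local Notation leb := (@lebesgue_measure R).

Definition cV_cons k (z : measurableTypeR R * 'cV[R]_k) : 'cV[R]_(1 + k) :=
  col_mx (z.1 : R)%:M z.2.

(** Measurable inverse of [cV_cons]; it carries finite-measure exhaustions of the
    product over to column vectors. *)
Definition cV_uncons k (v : 'cV[R]_(1 + k)) : measurableTypeR R * 'cV[R]_k :=
  (usubmx v 0%R 0%R, dsubmx v).

Lemma cV_uncons_cons k : cancel (@cV_cons k) (@cV_uncons k).
Proof.
move=> [t x]; rewrite /cV_uncons /cV_cons /= col_mxKd; congr pair.
by rewrite col_mxKu mxE.
Qed.

Lemma measurable_cV_cons k : measurable_fun setT (@cV_cons k).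
Proof.
apply: measurable_fun_mx => i j; rewrite ord1 /cV_cons.
case: (split_ordP i) => l ->.
  under eq_fun do rewrite col_mxEu ord1 mxE eqxx mulr1n.
  exact: measurable_fst.
under eq_fun do rewrite col_mxEd.
exact: measurableT_comp (measurable_mx_coord _ _) (@measurable_snd _ _ _ _).
Qed.

Lemma measurable_cV_uncons k : measurable_fun setT (@cV_uncons k).
Proof.
apply: measurable_fun_pair.
  by under eq_fun do rewrite mxE; exact: measurable_mx_coord.
apply: measurable_fun_mx => i j; under eq_fun do rewrite mxE.
exact: measurable_mx_coord.
Qed.

Section cV_product.
Variables (k : nat) (m : {sigma_finite_measure set 'cV[R]_k -> \bar R}).

Definition cV_product := pushforward (leb \x m) (@cV_cons k).

Let cV_product0 : cV_product set0 = 0.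
Proof. by rewrite /cV_product /pushforward preimage_set0 measure0. Qed.

Let cV_product_ge0 A : 0 <= cV_product A.
Proof. by rewrite /cV_product /pushforward measure_ge0. Qed.

Let cV_product_sigma_additive : semi_sigma_additive cV_product.
Proof.
rewrite /cV_product.
have [mu <-] := pushforward_is_measure (leb \x m) (@measurable_cV_cons k).
exact: measure_semi_sigma_additive.
Qed.

HB.instance Definition _ := isMeasure.Build _ _ _ cV_product
  cV_product0 cV_product_ge0 cV_product_sigma_additive.

Let cV_product_sigma_finite : sigma_finite setT cV_product.
Proof.
have /sigma_finiteP[F [TF ndF Foo]] := sigma_finiteT leb.
have /sigma_finiteP[G [TG ndG Goo]] := sigma_finiteT m.
exists (fun n => @cV_uncons k @^-1` (F n `*` G n)) => [|n].
  rewrite -preimage_bigcup (_ : \bigcup_n (F n `*` G n) = setT) ?preimage_setT//.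
  rewrite -subTset => -[t x] _.
  have [i _ Fi] : (\bigcup_n F n) t by rewrite -TF.
  have [j _ Gj] : (\bigcup_n G n) x by rewrite -TG.
  exists (maxn i j) => //; split.
    by move: t Fi; exact/subsetPset/ndF/leq_maxl.
  by move: x Gj; exact/subsetPset/ndG/leq_maxr.
have [mF Fn] := Foo n; have [mG Gn] := Goo n; split.
  rewrite -[X in measurable X]setTI.
  by apply: measurable_cV_uncons => //; exact: measurableX.
rewrite /cV_product /pushforward [X in _ X < _](_ : _ = F n `*` G n); last first.
  by apply/seteqP; split=> z; rewrite /preimage/mkset cV_uncons_cons.
by rewrite product_measure1E// lte_mul_pinfty// ge0_fin_numE.
Qed.

HB.instance Definition _ := Measure_isSigmaFinite.Build _ _ _ cV_product
  cV_product_sigma_finite.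

End cV_product.

(** The measure structure is obtained by induction on the dimension, because
    forming the product with the real line requires sigma-finiteness in the
    previous dimension. *)
Lemma lebesgue_cV_is_measure n :
  exists m : {sigma_finite_measure set 'cV[R]_n -> \bar R},
    (m : set _ -> \bar R) = lebesgue_cV R n.
Proof.
elim: n => [|n [m mE]]; first by exists (\d_(0%R : 'cV[R]_0)).
by exists (cV_product m); rewrite /= -mE.
Qed.

Section instances.
Variable n : nat.

Let lebesgue_cV0 : lebesgue_cV R n set0 = 0.
Proof. by have [m <-] := lebesgue_cV_is_measure n; exact: measure0. Qed.

Let lebesgue_cV_ge0 A : 0 <= lebesgue_cV R n A.
Proof. by have [m <-] := lebesgue_cV_is_measure n; exact: measure_ge0. Qed.

Let lebesgue_cV_sigma_additive : semi_sigma_additive (lebesgue_cV R n).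
Proof.
have [m <-] := lebesgue_cV_is_measure n; exact: measure_semi_sigma_additive.
Qed.

HB.instance Definition _ := isMeasure.Build _ _ _ (lebesgue_cV R n)
  lebesgue_cV0 lebesgue_cV_ge0 lebesgue_cV_sigma_additive.

Let lebesgue_cV_sigma_finite : sigma_finite setT (lebesgue_cV R n).
Proof. by have [m <-] := lebesgue_cV_is_measure n; exact: sigma_finiteT. Qed.

HB.instance Definition _ := Measure_isSigmaFinite.Build _ _ _ (lebesgue_cV R n)
  lebesgue_cV_sigma_finite.

End instances.

Lemma integral_lebesgue_cV0 (f : 'cV[R]_0 -> \bar R) :
  measurable_fun setT f -> \int[lebesgue_cV R 0]_x f x = f 0%R.
Proof. by move=> mf; rewrite /= integral_dirac// diracT mul1e. Qed.

Lemma ge0_integral_lebesgue_cVS n (f : 'cV[R]_(1 + n) -> \bar R) :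
  measurable_fun setT f -> (forall x, 0 <= f x) ->
  \int[lebesgue_cV R n.+1]_x f x =
  \int[leb]_t \int[lebesgue_cV R n]_x f (cV_cons (t, x)).
Proof.
move=> mf f0; rewrite /= (ge0_integral_pushforward (@measurable_cV_cons n))//.
rewrite preimage_setT fubini_tonelli1//; last by move=> z; exact: f0.
exact: measurableT_comp mf (@measurable_cV_cons n).
Qed.

Lemma ge0_integral_shift (f : R -> \bar R) (a : R) :
  measurable_fun setT f -> (forall x, 0 <= f x) ->
  \int[leb]_x f (x + a)%R = \int[leb]_x f x.
Proof.
move=> mf f0; pose phi (x : measurableTypeR R) : measurableTypeR R := (x + a)%R.
have mphi : measurable_fun setT phi by exact: measurable_funD.
rewrite [RHS](@ge0_integral_image _ _ _ _ _ leb leb phi)// => A mA.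
have [mu muE] := pushforward_is_measure leb mphi.
rewrite -[RHS]/(pushforward leb phi A) -muE.
apply: lebesgue_measure_unique => // _ [[b c]] _ <-; rewrite muE /pushforward.
rewrite [X in _ = _ X](_ : _ = `](b - a)%R, (c - a)%R]%classic); last first.
  by apply/seteqP; split=> x /=; rewrite !in_itv/= ltrBlDr lerBrDr.
rewrite lebesgue_measure_itv [RHS]lebesgue_measure_itv/= !lte_fin ltrD2r.
by rewrite -!EFinD opprB addrA subrK.
Qed.

Lemma measurable_col_mx d (T : measurableType d) m n p (f : T -> 'M[R]_(m, p))
    (g : T -> 'M[R]_(n, p)) :
  measurable_fun setT f -> measurable_fun setT g ->
  measurable_fun setT (fun t => col_mx (f t) (g t)).
Proof.
move=> mf mg; apply: measurable_fun_mx => i j; case: (split_ordP i) => l ->.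
  under eq_fun do rewrite col_mxEu.
  exact: measurableT_comp (measurable_mx_coord _ _) mf.
under eq_fun do rewrite col_mxEd.
exact: measurableT_comp (measurable_mx_coord _ _) mg.
Qed.

Lemma measurable_mxD d (T : measurableType d) m n (f g : T -> 'M[R]_(m, n)) :
  measurable_fun setT f -> measurable_fun setT g ->
  measurable_fun setT (fun t => f t + g t)%R.
Proof.
move=> mf mg; apply: measurable_fun_mx => i j; under eq_fun do rewrite mxE.
by apply: measurable_funD; exact: measurableT_comp (measurable_mx_coord _ _) _.
Qed.

(** One coordinate at a time, by Tonelli. *)
Lemma ge0_integral_cV_shift n (f : 'cV[R]_n -> \bar R) (a : 'cV[R]_n) :
  measurable_fun setT f -> (forall x, 0 <= f x) ->
  \int[lebesgue_cV R n]_x f (x + a)%R = \int[lebesgue_cV R n]_x f x.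
Proof.
elim: n f a => [|n ih] f a mf f0.
  by apply: eq_integral => x _; congr f; apply/matrixP => -[].
have mcons := @measurable_cV_cons n.
have mfa : measurable_fun setT (fun x : 'cV[R]_n.+1 => f (x + a)%R).
  by apply: measurableT_comp mf _; exact: measurable_mxD.
rewrite !ge0_integral_lebesgue_cVS//.
rewrite -[in RHS](@ge0_integral_shift _ (usubmx (a : 'cV_(1 + n)) 0%R 0%R)); last 2 first.
- apply: (measurable_fun_fubini_tonelli_F (fun z => f (cV_cons z))) => //.
  exact: measurableT_comp mf mcons.
- by move=> x; exact: integral_ge0.
apply: eq_integral => t _.
rewrite -[in RHS](@ih _ (dsubmx (a : 'cV_(1 + n))))//; last first.
  apply: (measurableT_comp mf); apply: (measurableT_comp mcons).
  exact: measurable_fun_pair.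
apply: eq_integral => x _; congr f; rewrite /cV_cons /=.
transitivity (col_mx (t%:M) x + col_mx (usubmx (a : 'cV_(1 + n)))
    (dsubmx (a : 'cV_(1 + n))) : 'cV[R]_(1 + n))%R; first by rewrite vsubmxK.
by rewrite add_col_mx [X in col_mx (_ + X)]mx11_scalar -raddfD.
Qed.

End LebesgueVectors.

(** * Gaussian integrals *)

Section GaussianIntegrals.
Variable R : realType.
Local Notation leb := (@lebesgue_measure R).
Local Notation lebn := (lebesgue_cV R).

Lemma measurable_enorm_sqr n :
  measurable_fun setT (fun v : 'cV[R]_n => enorm v ^+ 2).
Proof.
under eq_fun do rewrite enorm_sqr.
by apply: measurable_sum => i; apply: measurable_funX; exact: measurable_mx_coord.
Qed.

Lemma measurable_linear_form n (w : 'cV[R]_n) :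
  measurable_fun setT (fun v : 'cV[R]_n => \sum_i w i 0 * v i 0).
Proof.
apply: measurable_sum => i; apply: measurable_funM => //.
exact: measurable_mx_coord.
Qed.

Lemma measurable_gauss d (T : measurableType d) (a : R) (f : T -> R) :
  measurable_fun setT f -> measurable_fun setT (fun t => expR (- a * f t)).
Proof.
by move=> mf; apply: measurableT_comp => //; exact: measurable_funM.
Qed.

Lemma enorm_cV_cons n t (x : 'cV[R]_n) :
  enorm (cV_cons (t, x)) ^+ 2 = t ^+ 2 + enorm x ^+ 2.
Proof.
by rewrite /cV_cons enorm_col_mx /= [enorm t%:M ^+ 2]enorm_sqr big_ord1 mxE.
Qed.

Lemma integral_gauss_lty (a : R) : 0 < a ->
  (\int[leb]_t (expR (- a * t ^+ 2))%:E < +oo)%E.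
Proof.
move=> a0; pose s := Num.sqrt (2 * a)^-1.
have s2 : s ^+ 2 = (2 * a)^-1 by rewrite sqr_sqrtr// invr_ge0 mulr_ge0// ltW.
have s0 : s != 0 by rewrite gt_eqF// sqrtr_gt0 invr_gt0 mulr_gt0.
have eE t : expR (- a * t ^+ 2) = (normal_peak s)^-1 * normal_pdf 0 s t.
  rewrite normal_pdfE// mulKf ?gt_eqF ?normal_peak_gt0//.
  by rewrite /normal_fun subr0 s2; congr expR; field; rewrite gt_eqF.
under eq_integral do rewrite eE EFinM.
rewrite ge0_integralZl//.
- by rewrite integral_normal_pdf mule1 ltry.
- by apply/measurable_EFinP; exact: measurable_normal_pdf.
- by move=> t _; rewrite lee_fin normal_pdf_ge0.
- by rewrite lee_fin invr_ge0 normal_peak_ge0.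
Qed.

Lemma integral_gauss_cV_lty (a : R) n : 0 < a ->
  (\int[lebn n]_x (expR (- a * enorm x ^+ 2))%:E < +oo)%E.
Proof.
move=> a0; elim: n => [|n ih].
  rewrite integral_lebesgue_cV0 ?ltry//; apply/measurable_EFinP.
  exact: measurable_gauss (@measurable_enorm_sqr _).
rewrite ge0_integral_lebesgue_cVS; last 2 first.
- apply/measurable_EFinP; exact: measurable_gauss (@measurable_enorm_sqr n.+1).
- by move=> x; rewrite lee_fin expR_ge0.
set J := (X in (X < _)%E) in ih.
rewrite (eq_integral (fun t : measurableTypeR R =>
    (expR (- a * (t : R) ^+ 2))%:E * J)%E); last first.
  move=> t _; rewrite /J -ge0_integralZl//.
  - apply: eq_integral => x _.
    by rewrite enorm_cV_cons -EFinM -expRD -mulrDr.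
  - apply/measurable_EFinP; exact: measurable_gauss (@measurable_enorm_sqr _).
rewrite ge0_integralZr//.
- apply: lte_mul_pinfty ih; rewrite ?ge0_fin_numE ?integral_gauss_lty//.
  + by apply: integral_ge0 => x _; rewrite lee_fin expR_ge0.
  + by apply: integral_ge0 => x _; rewrite lee_fin expR_ge0.
- apply/measurable_EFinP; apply: measurable_gauss; exact: measurable_funX.
- by apply: integral_ge0 => x _; rewrite lee_fin expR_ge0.
Qed.

(** On one of the two components of [1/2 <= |t| <= 1] the numbers [w t] and [s]
    have the same sign, and there [(w t + s)^2 >= w^2 / 4 + s^2]. *)
Lemma integral_affine_sqr_ge (b c w s : R) : 0 <= b -> 0 <= c ->
  ((8^-1 * expR (- b) * (c + (w ^+ 2 + s ^+ 2)))%:E <=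
   \int[leb]_t ((c + (w * t + s) ^+ 2) * expR (- b * t ^+ 2))%:E)%E.
Proof.
move=> b0 c0; pose F t := (c + (w * t + s) ^+ 2) * expR (- b * t ^+ 2).
have mF : measurable_fun setT (EFin \o F).
  apply/measurable_EFinP; apply: measurable_funM.
    apply: measurable_funD => //; apply: measurable_funX.
    by apply: measurable_funD => //; exact: measurable_funM.
  by apply: measurable_gauss; exact: measurable_funX.
have F0 t : (0 <= (EFin \o F) t)%E.
  by rewrite lee_fin mulr_ge0 ?addr_ge0 ?sqr_ge0 ?expR_ge0.
have key (x y : R) : x <= y -> y - x = 2^-1 ->
    (forall t, x <= t <= y -> 4^-1 <= t ^+ 2 <= 1 /\ 0 <= w * t * s) ->
    ((8^-1 * expR (- b) * (c + (w ^+ 2 + s ^+ 2)))%:E <= \int[leb]_t (F t)%:E)%E.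
  move=> xy yx hxy.
  apply: (@le_trans _ _ (\int[leb]_(t in `[x, y]) (F t)%:E)%E); last first.
    by apply: ge0_subset_integral => // t _; exact: F0.
  apply: (@le_trans _ _ (\int[leb]_(t in `[x, y])
      (expR (- b) * (4^-1 * (c + (w ^+ 2 + s ^+ 2))))%:E)%E).
    rewrite integral_cst//= lebesgue_measure_itv/= lte_fin.
    have -> : x < y by rewrite -subr_gt0 yx.
    by rewrite -EFinB -EFinM lee_fin yx; lra.
  apply: ge0_le_integral => //.
  - by move=> t _; rewrite lee_fin !mulr_ge0// ?expR_ge0 ?addr_ge0 ?sqr_ge0.
  - exact: measurable_funTS.
  - move=> t; rewrite /= in_itv/= => /hxy[/andP[t1 t2] wts].
    rewrite lee_fin /F mulrC ler_pM ?expR_ge0//.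
    + by rewrite !mulr_ge0 ?addr_ge0 ?sqr_ge0.
    + have := sqr_ge0 w; have := sqr_ge0 s; nra.
    + by rewrite ler_expR; nra.
have [ws|ws] := leP 0 (w * s).
  apply: (key 2^-1 1) => [||t /andP[t1 t2]]; [lra|lra|split; [apply/andP; split; nra|]].
  by rewrite mulrAC mulr_ge0//; lra.
apply: (key (-1) (- 2^-1)) => [||t /andP[t1 t2]]; [lra|lra|split; [apply/andP; split; nra|]].
by rewrite mulrAC mulr_le0//; [exact: ltW|lra].
Qed.

(** The square [s^2] of the constant is included on the left so that the bound is
    stable under integrating out one more coordinate [t], which replaces [s] by
    [w0 t + s]. *)
Lemma integral_affine_form_sqr_ge (b : R) n (w : 'cV[R]_n) s : 0 <= b ->
  (((8^-1 * expR (- b)) ^+ n * (enorm w ^+ 2 + s ^+ 2))%:E <=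
   \int[lebn n]_x ((\sum_i w i 0 * x i 0 + s) ^+ 2
                   * expR (- b * enorm x ^+ 2))%:E)%E.
Proof.
move=> b0; set k := 8^-1 * expR (- b).
have k0 : 0 <= k by rewrite mulr_ge0// expR_ge0.
have mF m (v : 'cV[R]_m) c : measurable_fun setT (fun x : 'cV[R]_m =>
    ((\sum_i v i 0 * x i 0 + c) ^+ 2 * expR (- b * enorm x ^+ 2))%:E).
  apply/measurable_EFinP; apply: measurable_funM.
    apply: measurable_funX; apply: measurable_funD => //.
    exact: measurable_linear_form.
  exact: measurable_gauss (@measurable_enorm_sqr _).
elim: n w s => [|n ih] w s.
  rewrite integral_lebesgue_cV0// !enorm_sqr !big_ord0.
  by rewrite expr0 mulr0 expR0 mulr1 !add0r mul1r.
rewrite ge0_integral_lebesgue_cVS//; last first.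
  by move=> x; rewrite lee_fin mulr_ge0 ?sqr_ge0 ?expR_ge0.
pose w0 := (w : 'cV_(1 + n)) (lshift n ord0) 0.
pose w' := dsubmx (w : 'cV_(1 + n)).
have wE : enorm w ^+ 2 = w0 ^+ 2 + enorm w' ^+ 2.
  rewrite (@enorm_usubmx _ 1 n) [enorm (usubmx _) ^+ 2]enorm_sqr big_ord1 mxE//.
have sE t (x : 'cV[R]_n) : \sum_i w i 0 * cV_cons (t, x) i 0 + s =
    \sum_i w' i 0 * x i 0 + (w0 * t + s).
  rewrite (@big_split_ord _ _ _ 1 n) big_ord1 /cV_cons col_mxEu mxE eqxx mulr1n /=.
  rewrite addrAC addrC; congr (_ + _).
  by apply: eq_bigr => i _; rewrite col_mxEd mxE.
apply: (@le_trans _ _ (\int[leb]_t (k ^+ n * ((enorm w' ^+ 2 + (w0 * t + s) ^+ 2) *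
    expR (- b * t ^+ 2)))%:E)%E); last first.
  apply: ge0_le_integral => //.
  - by move=> t _; rewrite lee_fin !mulr_ge0 ?expR_ge0 ?exprn_ge0 ?addr_ge0 ?sqr_ge0.
  - apply/measurable_EFinP; apply: measurable_funM => //; apply: measurable_funM.
      apply: measurable_funD => //; apply: measurable_funX.
      by apply: measurable_funD => //; exact: measurable_funM.
    by apply: measurable_gauss; exact: measurable_funX.
  - apply: (measurable_fun_fubini_tonelli_F (fun z => ((\sum_i w i 0 * cV_cons z i 0 + s) ^+ 2
      * expR (- b * enorm (cV_cons z) ^+ 2))%:E)).
    + exact: measurableT_comp (mF n.+1 w s) (@measurable_cV_cons R n).
    + by move=> z; rewrite lee_fin mulr_ge0 ?sqr_ge0 ?expR_ge0.
  - move=> t _; rewrite mulrA mulrC EFinM.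
    apply: le_trans (lee_wpmul2l _ (ih w' (w0 * t + s))) _; first by rewrite lee_fin expR_ge0.
    rewrite -ge0_integralZl//.
    + apply: ge0_le_integral => //.
      * move=> x _; rewrite -EFinM lee_fin mulr_ge0 ?expR_ge0//.
        by rewrite mulr_ge0 ?sqr_ge0 ?expR_ge0.
      * by apply: emeasurable_funM => //; exact: measurable_cst.
      * apply: measurableT_comp (mF n.+1 w s) _.
        apply: measurableT_comp (@measurable_cV_cons R n) _.
        exact: measurable_fun_pair.
      * move=> x _; rewrite sE enorm_cV_cons -EFinM lee_fin mulrCA -expRD -mulrDr//.
    + by move=> x _; rewrite lee_fin mulr_ge0 ?sqr_ge0 ?expR_ge0.
under eq_integral do rewrite EFinM.
rewrite ge0_integralZl//.
- rewrite wE exprSr -mulrA EFinM lee_wpmul2l ?lee_fin ?exprn_ge0//.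
  rewrite -addrA [w0 ^+ 2 + _]addrCA; exact: integral_affine_sqr_ge (sqr_ge0 _).
- apply/measurable_EFinP; apply: measurable_funM.
    apply: measurable_funD => //; apply: measurable_funX.
    by apply: measurable_funD => //; exact: measurable_funM.
  by apply: measurable_gauss; exact: measurable_funX.
- by move=> t _; rewrite lee_fin mulr_ge0 ?addr_ge0 ?sqr_ge0 ?expR_ge0.
- by rewrite lee_fin exprn_ge0.
Qed.

End GaussianIntegrals.

(** * Measures given by a density *)

Section SetFunctions.
Context d (T : measurableType d) (R : realType).
Local Open Scope ereal_scope.
Import HBNNSimple.

(** The operators act on set functions defined on all sets; only the values on
    measurable sets are meaningful, and only they enter an integral. *)
Definition eq_on_measurable (m1 m2 : set T -> \bar R) : Prop :=
  forall A, measurable A -> m1 A = m2 A.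

Lemma eq_on_measurable_integral (m1 m2 : set T -> \bar R) (f : T -> \bar R) :
  eq_on_measurable m1 m2 -> \int[m1]_x f x = \int[m2]_x f x.
Proof.
move=> m12.
have E (h : {nnsfun T >-> R}) : sintegral m1 h = sintegral m2 h.
  by apply: eq_fsbigr => x _; rewrite m12//; exact: measurable_sfunP.
rewrite /integral; congr (ereal_sup _ - ereal_sup _);
  by apply/seteqP; split=> _ [h hf <-]; exists h => //; rewrite E.
Qed.

Definition density_measure (nu : {measure set T -> \bar R}) (rho : T -> R) :=
  fun A => \int[nu]_(x in A) (rho x)%:E.

Section density.
Variables (nu : {measure set T -> \bar R}) (rho : T -> R).
Hypotheses (mrho : measurable_fun [set: T] rho) (rho0 : forall x, (0 <= rho x)%R).

Lemma density_measure_is_measure :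
  exists m : {measure set T -> \bar R},
    (m : set T -> \bar R) = density_measure nu rho.
Proof.
have mrhoE : measurable_fun [set: T] (EFin \o rho) by exact/measurable_EFinP.
have m0 : density_measure nu rho set0 = 0 by exact: integral_set0.
have mge0 A : 0 <= density_measure nu rho A by apply: integral_ge0 => x _; rewrite lee_fin.
have madd : semi_sigma_additive (density_measure nu rho).
  move=> F mF tF mUF; rewrite /density_measure ge0_integral_bigcup//.
  - apply: is_cvg_ereal_nneg_natsum_cond => n _ _.
    by apply: integral_ge0 => x _; rewrite lee_fin.
  - exact: measurable_funTS.
  - by move=> x _; rewrite lee_fin.
by exists (HB.pack_for {measure set T -> \bar R} (density_measure nu rho)
  (isMeasure.Build _ _ _ _ m0 mge0 madd)).
Qed.

(** Linearity handles simple functions, and monotone convergence the rest. *)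
Lemma ge0_integral_density (m : {measure set T -> \bar R}) (f : T -> \bar R) :
  eq_on_measurable m (density_measure nu rho) ->
  measurable_fun [set: T] f -> (forall x, 0 <= f x) ->
  \int[m]_x f x = \int[nu]_x (f x * (rho x)%:E).
Proof.
move=> mE mf f0; pose f_ := nnsfun_approx measurableT mf.
have fE x : (fun n => (f_ n x)%:E) @ \oo --> f x by exact: cvg_nnsfun_approx.
have mf_ n : measurable_fun [set: T] (fun x => (f_ n x)%:E).
  exact/measurable_EFinP.
have mrhoE : measurable_fun [set: T] (fun x => (rho x)%:E) by exact/measurable_EFinP.
have nd x : nondecreasing_seq (fun n => (f_ n x)%:E).
  by move=> i j ij; rewrite lee_fin; exact/lefP/nd_nnsfun_approx.
transitivity (limn (fun n => \int[m]_x (f_ n x)%:E)).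
  rewrite -monotone_convergence//.
  - by apply: eq_integral => x _; apply/esym/cvg_lim.
  - by move=> n x _; rewrite lee_fin.
transitivity (limn (fun n => \int[nu]_x ((f_ n x)%:E * (rho x)%:E))); last first.
  rewrite -monotone_convergence//.
  - apply: eq_integral => x _; apply/cvg_lim => //.
    by under eq_fun do rewrite muleC; rewrite muleC; exact: cvgeZl.
  - by move=> n; exact: emeasurable_funM.
  - by move=> n x _; rewrite mule_ge0 ?lee_fin.
  - by move=> x _ i j ij; rewrite lee_wpmul2r ?lee_fin//; exact/lefP/nd_nnsfun_approx.
apply: congr_lim; apply/funext => n; pose h := f_ n.
have mlevel r : measurable (h @^-1` [set r]) by exact: measurable_sfunP.
have mone r : measurable_fun [set: T] (fun x => (\1_(h @^-1` [set r]) x * rho x)%:E).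
  by apply/measurable_EFinP; apply: measurable_funM => //; exact: measurable_indic.
rewrite -/h integralT_nnsfun sintegralE.
transitivity (\sum_(r \in range h)
    \int[nu]_x (r%:E * (\1_(h @^-1` [set r]) x * rho x)%:E)).
  apply: eq_fsbigr => r; rewrite inE => -[t _ <-].
  rewrite ge0_integralZl ?lee_fin//; last by move=> x _; rewrite lee_fin mulr_ge0.
  congr (_ * _); rewrite mE// /density_measure integral_mkcond.
  apply: eq_integral => x _; rewrite patchE indicE.
  by case: ifPn => _; rewrite ?mul1r ?mul0r.
rewrite -ge0_integral_fsum//.
- apply: eq_integral => x _; rewrite [in RHS]fimfunE -fsumEFin//.
  rewrite ge0_mule_fsuml; last by move=> r; rewrite EFinM nnfun_muleindic_ge0.
  by apply: eq_fsbigr => r _; rewrite -!EFinM mulrA.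
- by move=> r; apply: emeasurable_funM => //; exact: measurable_cst.
- by move=> r x _; rewrite EFinM muleA mule_ge0 ?nnfun_muleindic_ge0 ?lee_fin.
Qed.

End density.
End SetFunctions.

(** * Integrals and moments of functions of quadratic growth *)

Section MatrixMaps.
Context d (T : measurableType d) (R : realType).

Lemma measurable_mxN m n (f : T -> 'M[R]_(m, n)) :
  measurable_fun setT f -> measurable_fun setT (fun t => - f t).
Proof.
move=> mf; apply: measurable_fun_mx => i j; under eq_fun do rewrite mxE.
by apply: measurableT_comp => //; exact: measurableT_comp (measurable_mx_coord _ _) mf.
Qed.

Lemma measurable_mxB m n (f g : T -> 'M[R]_(m, n)) :
  measurable_fun setT f -> measurable_fun setT g ->
  measurable_fun setT (fun t => f t - g t).
Proof. by move=> mf mg; apply: measurable_mxD => //; exact: measurable_mxN. Qed.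

Lemma measurable_mulmx m n p (A : 'M[R]_(m, n)) (f : T -> 'M[R]_(n, p)) :
  measurable_fun setT f -> measurable_fun setT (fun t => A *m f t).
Proof.
move=> mf; apply: measurable_fun_mx => i j; under eq_fun do rewrite mxE.
apply: measurable_sum => k; apply: measurable_funM => //.
exact: measurableT_comp (measurable_mx_coord _ _) mf.
Qed.

Lemma measurable_usubmx m n p (f : T -> 'M[R]_(m + n, p)) :
  measurable_fun setT f -> measurable_fun setT (fun t => usubmx (f t)).
Proof.
move=> mf; apply: measurable_fun_mx => i j; under eq_fun do rewrite mxE.
exact: measurableT_comp (measurable_mx_coord _ _) mf.
Qed.

Lemma measurable_dsubmx m n p (f : T -> 'M[R]_(m + n, p)) :
  measurable_fun setT f -> measurable_fun setT (fun t => dsubmx (f t)).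
Proof.
move=> mf; apply: measurable_fun_mx => i j; under eq_fun do rewrite mxE.
exact: measurableT_comp (measurable_mx_coord _ _) mf.
Qed.

Lemma measurable_enorm_sqr_comp n (f : T -> 'cV[R]_n) :
  measurable_fun setT f -> measurable_fun setT (fun t => enorm (f t) ^+ 2).
Proof. by move=> mf; exact: measurableT_comp (@measurable_enorm_sqr R n) mf. Qed.

End MatrixMaps.

Section RealIntegrable.
Context d (T : measurableType d) (R : realType) (mu : {measure set T -> \bar R}).

Lemma integrable_addr (f g : T -> R) :
  mu.-integrable setT (EFin \o f) -> mu.-integrable setT (EFin \o g) ->
  mu.-integrable setT (EFin \o (fun x => f x + g x)).
Proof. by move=> hf hg; exact: (integrableD measurableT hf hg). Qed.

Lemma integrable_mulr (c : R) (f : T -> R) : mu.-integrable setT (EFin \o f) ->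
  mu.-integrable setT (EFin \o (fun x => c * f x)).
Proof. by move=> hf; exact: (integrableZl measurableT c hf). Qed.

Lemma integrable_sumr (I : Type) (s : seq I) (h : I -> T -> R) :
  (forall i, mu.-integrable setT (EFin \o h i)) ->
  mu.-integrable setT (EFin \o (fun x => \sum_(i <- s) h i x)).
Proof.
move=> ih; elim: s => [|i s IH].
  have -> : (fun x => \sum_(i <- [::]) h i x) = cst 0.
    by apply/funext => x; rewrite big_nil.
  exact: integrable0.
have -> : (fun x => \sum_(j <- i :: s) h j x) =
    (fun x => h i x + \sum_(j <- s) h j x).
  by apply/funext => x; rewrite big_cons.
exact: integrable_addr.
Qed.

End RealIntegrable.

Lemma Rintegral_sum d (T : measurableType d) (R : realType)
    (mu : {measure set T -> \bar R}) (I : Type) (s : seq I) (h : I -> T -> R) :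
  (forall i, mu.-integrable setT (EFin \o h i)) ->
  \int[mu]_x (\sum_(i <- s) h i x) = \sum_(i <- s) \int[mu]_x h i x.
Proof.
move=> ih; elim: s => [|i s IH].
  under eq_Rintegral do rewrite big_nil.
  by rewrite big_nil Rintegral_cst// mul0r.
rewrite big_cons -IH -RintegralD//.
  by under eq_Rintegral do rewrite big_cons.
exact: integrable_sumr.
Qed.

Section Moments.
Variables (R : realType) (n : nat).
Local Notation V := 'cV[R]_n.

Lemma g_weight_ge1 (x : V) : 1 <= g_weight x.
Proof. by rewrite lerDl sqr_ge0. Qed.

Lemma g_weight_ge0 (x : V) : 0 <= g_weight x.
Proof. exact: le_trans (g_weight_ge1 x). Qed.

Lemma measurable_g_weight : measurable_fun setT (@g_weight R n).
Proof. by apply: measurable_funD => //; exact: measurable_enorm_sqr. Qed.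

Lemma coord_le_weight i (x : V) : `|x i 0| <= g_weight x.
Proof.
have := coord_le_enorm x i; have := enorm_ge0 x; rewrite /g_weight; nra.
Qed.

Lemma coordM_le_weight i j (x : V) : `|x i 0 * x j 0| <= g_weight x.
Proof.
rewrite normrM; have := coord_le_enorm x i; have := coord_le_enorm x j.
have := normr_ge0 (x i 0); have := normr_ge0 (x j 0); rewrite /g_weight; nra.
Qed.

Variable m : {measure set V -> \bar R}.
Hypothesis ig : m.-integrable setT (EFin \o @g_weight R n).

Lemma integrable_le_weight (f : V -> R) C : measurable_fun setT f ->
  (forall x, `|f x| <= C * g_weight x) -> m.-integrable setT (EFin \o f).
Proof.
move=> mf fC; apply: (le_integrable measurableT _ _ (integrableZl measurableT C ig)).
  exact/measurable_EFinP.
move=> x _; rewrite /= lee_fin (le_trans (fC x))//.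
by rewrite ler_norm.
Qed.

Lemma integrable_weight1 (f : V -> R) : measurable_fun setT f ->
  (forall x, `|f x| <= g_weight x) -> m.-integrable setT (EFin \o f).
Proof.
by move=> mf fC; apply: (@integrable_le_weight f 1) => // x; rewrite mul1r.
Qed.

Lemma integrable_coord i : m.-integrable setT (EFin \o (fun x : V => x i 0)).
Proof.
apply: integrable_weight1 (coord_le_weight i); exact: measurable_mx_coord.
Qed.

Lemma integrable_coordM i j :
  m.-integrable setT (EFin \o (fun x : V => x i 0 * x j 0)).
Proof.
apply: integrable_weight1 (coordM_le_weight i j).
by apply: measurable_funM; exact: measurable_mx_coord.
Qed.

Lemma integrable_cst_weight (c : R) : m.-integrable setT (EFin \o (fun _ : V => c)).
Proof.
apply: (@integrable_le_weight _ `|c|) => // x.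
by rewrite ler_peMr// g_weight_ge1.
Qed.

Lemma Rintegral_le_weight (f : V -> R) : measurable_fun setT f ->
  (forall x, `|f x| <= g_weight x) -> `|\int[m]_x f x| <= \int[m]_x g_weight x.
Proof.
move=> mf fg; have i_f := integrable_weight1 mf fg.
apply: le_trans (le_normr_Rintegral measurableT i_f) _.
by apply: le_Rintegral => //; exact: integrable_norm.
Qed.

Lemma meanE i : mean m i 0 = \int[m]_x x i 0.
Proof. by rewrite mxE. Qed.

Lemma integrable_centered i j : m.-integrable setT
  (EFin \o (fun x : V => (x i 0 - mean m i 0) * (x j 0 - mean m j 0))).
Proof.
have -> : (fun x : V => (x i 0 - mean m i 0) * (x j 0 - mean m j 0)) =
  (fun x => (x i 0 * x j 0 + (- mean m i 0) * x j 0) +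
            ((- mean m j 0) * x i 0 + mean m i 0 * mean m j 0)).
  by apply/funext => x; ring.
by do 2!apply: integrable_addr; rewrite ?integrable_cst_weight//;
  do 1?[exact: integrable_coordM|apply: integrable_mulr; exact: integrable_coord].
Qed.

(** For a probability measure the last factor is [1]; otherwise expanding the
    product leaves the deviation of the total mass from [1] in it. *)
Lemma covE i j : cov m i j = \int[m]_x (x i 0 * x j 0)
  - mean m i 0 * mean m j 0 * (2 - \int[m]_x 1).
Proof.
rewrite mxE -/(Rintegral _ _ _).
have -> : \int[m]_x ((x i 0 - mean m i 0) * (x j 0 - mean m j 0)) =
  \int[m]_x ((x i 0 * x j 0 + (- mean m i 0) * x j 0) +
            ((- mean m j 0) * x i 0 + mean m i 0 * mean m j 0 * 1)).
  by apply: eq_Rintegral => x _; ring.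
have iZ (c : R) k : m.-integrable setT (EFin \o (fun x : V => c * x k 0)).
  by apply: integrable_mulr; exact: integrable_coord.
have i1 (c : R) : m.-integrable setT (EFin \o (fun x : V => c * 1)).
  by apply: integrable_mulr; exact: integrable_cst_weight.
rewrite RintegralD//; last 2 first.
- by apply: integrable_addr => //; exact: integrable_coordM.
- exact: integrable_addr.
rewrite RintegralD ?integrable_coordM// RintegralD//.
rewrite !RintegralZl ?integrable_coord ?integrable_cst_weight// -!meanE.
ring.
Qed.

Lemma sqr_centered_form (w x : V) :
  (\sum_i w i 0 * (x i 0 - mean m i 0)) ^+ 2 = \sum_i \sum_j
    w i 0 * w j 0 * ((x i 0 - mean m i 0) * (x j 0 - mean m j 0)) :> R.
Proof.
rewrite expr2 mulr_suml; apply: eq_bigr => i _.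
by rewrite mulr_sumr; apply: eq_bigr => j _; ring.
Qed.

Lemma integrable_sqr_centered_form (w : V) : m.-integrable setT
  (EFin \o (fun x : V => (\sum_i w i 0 * (x i 0 - mean m i 0)) ^+ 2)).
Proof.
under eq_fun do rewrite sqr_centered_form.
apply: integrable_sumr => i; apply: integrable_sumr => j.
by apply: integrable_mulr; exact: integrable_centered.
Qed.

Lemma qform_cov w :
  qform (cov m) w = \int[m]_x (\sum_i w i 0 * (x i 0 - mean m i 0)) ^+ 2.
Proof.
under eq_Rintegral do rewrite sqr_centered_form.
have i2 i j : m.-integrable setT (EFin \o (fun x : V =>
    w i 0 * w j 0 * ((x i 0 - mean m i 0) * (x j 0 - mean m j 0)))).
  by apply: integrable_mulr; exact: integrable_centered.
rewrite Rintegral_sum => [|i]; last exact: integrable_sumr.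
rewrite qformE; apply: eq_bigr => i _.
rewrite Rintegral_sum// mxE mulr_sumr; apply: eq_bigr => j _.
rewrite RintegralZl//; last exact: integrable_centered.
by rewrite mxE /Rintegral; ring.
Qed.

End Moments.

(** * Stability of mean and covariance under the weighted distance *)

Section WeightedDistance.
Variables (R : realType) (n : nat).
Local Notation V := 'cV[R]_n.

Lemma integrable_g_weight (pi : probability V R) :
  (second_moment pi < +oo)%E -> pi.-integrable setT (EFin \o @g_weight R n).
Proof.
move=> h; apply: integrable_addr; first exact: finite_measure_integrable_cst.
apply/integrableP; split; first by apply/measurable_EFinP; exact: measurable_enorm_sqr.
by under eq_integral do rewrite /= ger0_norm ?sqr_ge0//.
Qed.

Lemma EFin_Rintegral (m : {measure set V -> \bar R}) (f : V -> R) :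
  m.-integrable setT (EFin \o f) -> (\int[m]_x (f x)%:E)%E = (\int[m]_x f x)%:E.
Proof. by move=> hf; rewrite fineK//; exact: integrable_fin_num. Qed.

Lemma dg_ge0 (m1 m2 : set V -> \bar R) : (0 <= dg m1 m2)%E.
Proof.
apply: (@le_trans _ _ `|\int[m1]_x (0 : R)%:E - \int[m2]_x (0 : R)%:E|%E) => //.
apply: ereal_sup_ubound; exists (fun=> 0) => //; split => // v.
by rewrite normr0 g_weight_ge0.
Qed.

Lemma dg_Rintegral (m1 m2 : {measure set V -> \bar R}) (D : R) (f : V -> R) :
  m1.-integrable setT (EFin \o @g_weight R n) ->
  m2.-integrable setT (EFin \o @g_weight R n) ->
  (dg m1 m2 <= D%:E)%E -> measurable_fun setT f ->
  (forall x, `|f x| <= g_weight x) ->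
  `|\int[m1]_x f x - \int[m2]_x f x| <= D.
Proof.
move=> i1 i2 hD mf fg; rewrite -lee_fin; apply: le_trans hD.
rewrite -[X in (X <= _)%E]/(`|(\int[m1]_x f x)%:E - (\int[m2]_x f x)%:E|%E).
rewrite -!EFin_Rintegral; [|exact: integrable_weight1..].
by apply: ereal_sup_ubound; exists f.
Qed.

End WeightedDistance.

Section CovarianceStability.
Variables (R : realType) (n : nat).
Local Notation V := 'cV[R]_n.

Lemma bilinear_delta (S : 'M[R]_n) i j :
  ((delta_mx i 0 : V)^T *m S *m (delta_mx j 0 : V)) 0 0 = S i j.
Proof. by rewrite trmx_delta -rowE -colE !mxE. Qed.

Lemma qform_scalar (a : R) (v : V) : qform a%:M v = a * enorm v ^+ 2.
Proof.
rewrite qformE mul_scalar_mx enorm_sqr mulr_sumr; apply: eq_bigr => i _.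
by rewrite mxE; ring.
Qed.

Lemma qformB (S S' : 'M[R]_n) v : qform (S - S') v = qform S v - qform S' v.
Proof. by rewrite /qform mulmxBr mulmxBl mxE [X in _ + X]mxE. Qed.

Lemma loewner_coercive (a : R) (S : 'M[R]_n) : loewner_le a%:M S -> coercive a S.
Proof. by move=> [_ h] v; rewrite -subr_ge0 -qform_scalar -qformB. Qed.

(** Off the diagonal, apply positivity to [e_i + e_j] and [e_i - e_j]. *)
Lemma psd_entry_le (b : R) (S : 'M[R]_n) : S^T = S -> (forall v, 0 <= qform S v) ->
  (forall v, qform S v <= b * enorm v ^+ 2) -> forall i j, `|S i j| <= b.
Proof.
move=> symS S0 Sb i j.
have diag k : S k k <= b.
  have := Sb (delta_mx k 0); rewrite /qform bilinear_delta.
  suff -> : enorm (delta_mx k 0 : V) ^+ 2 = 1 by rewrite mulr1.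
  rewrite enorm_sqr (bigD1 k)//= big1 ?addr0 ?mxE ?eqxx ?expr1n// => l lk.
  by rewrite mxE (negbTE lk) expr0n.
have comb (s : R) : 0 <= S i i + s * S i j + s * S i j + s * s * S j j.
  have := S0 (delta_mx i 0 + s *: delta_mx j 0); rewrite /qform.
  set a := delta_mx i 0; set b' := delta_mx j 0.
  have -> : (a + s *: b')^T = a^T + s *: b'^T.
    by apply/matrixP => x y; rewrite !mxE.
  rewrite !mulmxDl !mulmxDr -!scalemxAl -!scalemxAr.
  have E (A B : 'M[R]_1) : (A + B) 0 0 = A 0 0 + B 0 0 by rewrite mxE.
  have Z (c : R) (A : 'M[R]_1) : (c *: A) 0 0 = c * A 0 0 by rewrite mxE.
  rewrite !(E, Z) !bilinear_delta.
  have -> : S j i = S i j by rewrite -[in LHS]symS mxE.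
  by rewrite !addrA mulrA.
have := comb 1; have := comb (-1); have := diag i; have := diag j.
rewrite ler_norml => *; apply/andP; split; lra.
Qed.

Variables (pi : probability V R) (p : {measure set V -> \bar R}) (r M D : R).
Hypotheses (hr : 1 <= r) (hpi : in_PR r pi).
Hypothesis ip : p.-integrable setT (EFin \o @g_weight R n).
Hypothesis pM : \int[p]_x g_weight x <= M.
Hypothesis piD : forall f : V -> R, measurable_fun setT f ->
  (forall x, `|f x| <= g_weight x) -> `|\int[pi]_x f x - \int[p]_x f x| <= D.

Let ipi : pi.-integrable setT (EFin \o @g_weight R n).
Proof. by have [h _ _ _] := hpi; exact: integrable_g_weight. Qed.

Lemma cov_PR_coercive : coercive (r ^- 2) (cov pi).
Proof. by have [_ _ h _] := hpi; exact: loewner_coercive. Qed.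

Lemma cov_PR_le i j : `|cov pi i j| <= r ^+ 2.
Proof.
have [_ _ lo [hsym hup]] := hpi; apply: psd_entry_le => [|v|v].
- by have := lo.1; rewrite linearB /= tr_scalar_mx => /addIr.
- apply: le_trans (loewner_coercive lo v).
  by rewrite mulr_ge0 ?sqr_ge0// invr_ge0 exprn_ge0// (le_trans _ hr).
- by rewrite -subr_ge0 -qform_scalar -qformB; exact: hup.
Qed.

Let pbound (f : V -> R) : measurable_fun setT f ->
  (forall x, `|f x| <= g_weight x) -> `|\int[p]_x f x| <= M.
Proof. by move=> mf fg; apply: le_trans pM; exact: Rintegral_le_weight. Qed.

Let M0 : 0 <= M.
Proof. by apply: le_trans pM; apply: Rintegral_ge0 => x _; exact: g_weight_ge0. Qed.

Let mcoord i : measurable_fun setT (fun x : V => x i 0).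
Proof. exact: measurable_mx_coord. Qed.

Let mcoordM i j : measurable_fun setT (fun x : V => x i 0 * x j 0).
Proof. exact: measurable_funM. Qed.

Let norm1_le (x : V) : `|1 : R| <= g_weight x.
Proof. by rewrite normr1 g_weight_ge1. Qed.

Let p1M : `|\int[p]_x (1 : R)| <= M.
Proof. exact: pbound. Qed.

Let pi1 : \int[pi]_x (1 : R) = 1.
Proof.
by rewrite Rintegral_cst// mul1r (_ : _ setT = 1%E)//; exact: probability_setT.
Qed.

Let p1D : `|1 - \int[p]_x (1 : R)| <= D.
Proof.
have := piD (measurable_cst (1 : R)) norm1_le.
by rewrite pi1.
Qed.

Lemma cov_le i j : `|cov p i j| <= M + M * M * (2 + M).
Proof.
rewrite covE//; apply: le_trans (ler_normB _ _) _; apply: lerD.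
  by apply: pbound => // x; exact: coordM_le_weight.
rewrite !normrM; apply: ler_pM; rewrite ?mulr_ge0//.
  apply: ler_pM => //; rewrite meanE; apply: pbound => // x; exact: coord_le_weight.
by apply: le_trans (ler_normB _ _) _; rewrite normr_nat lerD2l.
Qed.

(** The mean and the second moments are integrals of functions dominated by the
    weight, hence [D]-close, and the covariance is a polynomial in them. *)
Lemma cov_stable i j :
  `|cov pi i j - cov p i j| <= (1 + r + M + M * M) * D.
Proof.
have mpi k : `|mean pi k 0| <= r.
  by have [_ h _ _] := hpi; apply: le_trans h; exact: coord_le_enorm.
have mp k : `|mean p k 0| <= M.
  by rewrite meanE; apply: pbound => // x; exact: coord_le_weight.
have dm k : `|mean pi k 0 - mean p k 0| <= D.
  by rewrite !meanE; apply: piD => // x; exact: coord_le_weight.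
have ds : `|\int[pi]_x (x i 0 * x j 0) - \int[p]_x (x i 0 * x j 0)| <= D.
  by apply: piD => // x; exact: coordM_le_weight.
rewrite !covE// pi1.
set s := \int[pi]_x _ in ds *; set s' := \int[p]_x (_ * _) in ds *.
set m1 := mean pi i 0; set m2 := mean pi j 0.
set m1' := mean p i 0; set m2' := mean p j 0; set q := \int[p]_x 1.
have dq : `|1 - q| <= D := p1D.
have -> : s - m1 * m2 * (2 - 1) - (s' - m1' * m2' * (2 - q)) =
  (s - s') - (m1 - m1') * m2 - m1' * (m2 - m2') + m1' * m2' * (1 - q) by ring.
apply: le_trans (ler_normD _ _) _.
apply: le_trans (lerD (le_trans (ler_normB _ _) (lerD (ler_normB _ _) (lexx _))) (lexx _)) _.
rewrite [leRHS]mulrDl [X in _ <= X + _]mulrDl [X in _ <= X + _ + _]mulrDl mul1r.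
do !apply: lerD => //.
- by rewrite normrM mulrC; apply: ler_pM => //; [exact: mpi|exact: dm].
- by rewrite normrM; apply: ler_pM => //; [exact: mp|exact: dm].
- rewrite !normrM; apply: ler_pM => //.
  by apply: ler_pM => //; exact: mp.
Qed.

End CovarianceStability.

(** * Shears and Gaussian profiles on the product space *)

(** An identity between integrals of nonnegative functions extends to signed ones:
    the integral is defined from positive and negative parts, and a nonnegative
    factor commutes with taking them. *)
Lemma integral_same_ge0 d1 d2 (T1 : measurableType d1) (T2 : measurableType d2)
    (R : realType) (m1 : {measure set T1 -> \bar R}) (m2 : {measure set T2 -> \bar R})
    (phi : T2 -> T1) (w : T2 -> R) :
  (forall z, 0 <= w z) ->
  (forall F : T1 -> \bar R, measurable_fun setT F -> (forall x, 0 <= F x)%E ->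
     (\int[m1]_x F x = \int[m2]_z (F (phi z) * (w z)%:E))%E) ->
  forall f : T1 -> R, measurable_fun setT f ->
    (\int[m1]_x (f x)%:E = \int[m2]_z (f (phi z) * w z)%:E)%E.
Proof.
move=> w0 H f mf; have mfE : measurable_fun setT (EFin \o f) by exact/measurable_EFinP.
rewrite integralE [RHS]integralE; congr (_ - _)%E.
- rewrite H//; last exact: measurable_funepos.
  by apply: eq_integral => z _; rewrite !funeposE /= EFinM maxe_pMl ?lee_fin ?mul0e.
- rewrite H//; last exact: measurable_funeneg.
  by apply: eq_integral => z _; rewrite !funenegE /= -mulNr EFinM maxe_pMl ?lee_fin ?mul0e.
Qed.

Section ProductSpace.
Variables (R : realType) (d K : nat).
Local Notation U := 'cV[R]_d.
Local Notation Y := 'cV[R]_K.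
Local Notation nu := (lebesgue_cV R d \x lebesgue_cV R K)%E.

Definition pair_col (z : U * Y) : 'cV[R]_(d + K) := col_mx z.1 z.2.

Lemma measurable_pair_col : measurable_fun setT pair_col.
Proof. by apply: measurable_col_mx; [exact: measurable_fst|exact: measurable_snd]. Qed.

Definition shear (B : Y -> U) (z : U * Y) : U * Y := (z.1 + B z.2, z.2).

Lemma measurable_shear (B : Y -> U) :
  measurable_fun setT B -> measurable_fun setT (shear B).
Proof.
move=> mB; apply: measurable_fun_pair; last exact: measurable_snd.
apply: measurable_mxD; first exact: measurable_fst.
exact: measurableT_comp mB (@measurable_snd _ _ _ _).
Qed.

Lemma ge0_integral_shear (B : Y -> U) (F : U * Y -> \bar R) :
  measurable_fun setT B -> measurable_fun setT F -> (forall z, 0 <= F z)%E ->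
  (\int[nu]_z F (shear B z) = \int[nu]_z F z)%E.
Proof.
move=> mB mF F0.
have mT := measurable_shear mB.
rewrite (@fubini_tonelli2 _ _ _ _ _ _ _ (fun z => F (shear B z)))//; last first.
  exact: measurableT_comp mF mT.
rewrite fubini_tonelli2//; apply: eq_integral => y _.
rewrite /fubini_G /=.
apply: (@ge0_integral_cV_shift R d (fun u => F (u, y)) (B y)) => //.
by apply: measurableT_comp mF _; exact: measurable_fun_pair.
Qed.

Lemma integral_shear (B : Y -> U) (f : U * Y -> R) :
  measurable_fun setT B -> measurable_fun setT f ->
  (\int[nu]_z (f (shear B z))%:E = \int[nu]_z (f z)%:E)%E.
Proof.
move=> mB mf; apply/esym.
rewrite (@integral_same_ge0 _ _ _ _ _ nu nu (shear B) (cst 1))//.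
  by apply: eq_integral => z _; rewrite mulr1.
move=> F mF F0; rewrite -(ge0_integral_shear mB mF F0).
by apply: eq_integral => z _; rewrite mule1.
Qed.

Definition weight2 (z : U * Y) : R := 1 + enorm z.1 ^+ 2 + enorm z.2 ^+ 2.

(** The Gaussian [exp (- a |(u, y)|^2)], used as upper and lower bound of densities. *)
Definition gprofile (a : R) (z : U * Y) : R :=
  expR (- a * (enorm z.1 ^+ 2 + enorm z.2 ^+ 2)).

Lemma weight2_ge1 z : 1 <= weight2 z.
Proof. by rewrite /weight2 -addrA lerDl addr_ge0 ?sqr_ge0. Qed.

Lemma measurable_sqr_norms :
  measurable_fun setT (fun z : U * Y => enorm z.1 ^+ 2 + enorm z.2 ^+ 2).
Proof.
by apply: measurable_funD; apply: measurable_enorm_sqr_comp;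
  [exact: measurable_fst|exact: measurable_snd].
Qed.

Lemma measurable_gprofile a : measurable_fun setT (gprofile a).
Proof. by apply: measurable_gauss; exact: measurable_sqr_norms. Qed.

Lemma measurable_weight2 : measurable_fun setT weight2.
Proof.
have -> : weight2 = (fun z => 1 + (enorm z.1 ^+ 2 + enorm z.2 ^+ 2)).
  by apply/funext => z; rewrite /weight2 addrA.
by apply: measurable_funD => //; exact: measurable_sqr_norms.
Qed.

Lemma gprofile_ge0 a z : 0 <= gprofile a z.
Proof. exact: expR_ge0. Qed.

Lemma gprofileE a z :
  gprofile a z = expR (- a * enorm z.1 ^+ 2) * expR (- a * enorm z.2 ^+ 2).
Proof. by rewrite -expRD -mulrDr. Qed.

Lemma integral_gprofile_lty a : 0 < a -> (\int[nu]_z (gprofile a z)%:E < +oo)%E.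
Proof.
move=> a0; have mg k : measurable_fun setT
    (fun x : 'cV[R]_k => (expR (- a * enorm x ^+ 2))%:E).
  by apply/measurable_EFinP; exact: measurable_gauss (@measurable_enorm_sqr R k).
have g0 k (x : 'cV[R]_k) : (0 <= (expR (- a * enorm x ^+ 2))%:E)%E.
  by rewrite lee_fin expR_ge0.
rewrite fubini_tonelli1; last 2 first.
- by apply/measurable_EFinP; exact: measurable_gprofile.
- by move=> z; rewrite lee_fin gprofile_ge0.
rewrite /fubini_F; under eq_integral => u _.
  under eq_integral do rewrite gprofileE EFinM /=.
  rewrite ge0_integralZl//; over.
rewrite ge0_integralZr//; last exact: integral_ge0.
apply: lte_mul_pinfty; rewrite ?ge0_fin_numE ?integral_gauss_cV_lty//;
  exact: integral_ge0.
Qed.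

(** [1 + s] is at most a multiple of [exp (a s / 4)], so its square costs only half
    of the exponential decay. *)
Lemma integral_weight2_gprofile a : 0 < a ->
  exists2 M : R, 0 <= M &
    (\int[nu]_z (weight2 z ^+ 2 * gprofile a z)%:E <= M%:E)%E.
Proof.
move=> a0; pose k := Num.min 1 (a / 4).
have k0 : 0 < k by rewrite lt_min ltr01 divr_gt0.
have bnd z : weight2 z ^+ 2 * gprofile a z <= k ^- 2 * gprofile (a / 2) z.
  rewrite /weight2 /gprofile -addrA; set s := enorm z.1 ^+ 2 + enorm z.2 ^+ 2.
  have s0 : 0 <= s by rewrite addr_ge0 ?sqr_ge0.
  have h : k * (1 + s) <= expR (a / 4 * s).
    apply: le_trans (expR_ge1Dx _).
    have k1 : k <= 1 by rewrite ge_min lexx.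
    have k2 : k <= a / 4 by rewrite ge_min lexx orbT.
    by nra.
  have -> : - a * s = - (2%:R * (a / 4 * s)) + - (a / 2) * s by field.
  rewrite expRD expRN expRM_natl mulrA; apply: ler_wpM2r; first exact: expR_ge0.
  rewrite ler_pdivrMr ?exprn_gt0 ?expR_gt0//.
  rewrite ler_pdivlMl ?exprn_gt0// -exprMn.
  have ks : 0 <= k * (1 + s) by rewrite mulr_ge0 ?(ltW k0)// addr_ge0.
  by rewrite lerXn2r// nnegrE expR_ge0.
have fin : (\int[nu]_z (gprofile (a / 2) z)%:E < +oo)%E.
  by apply: integral_gprofile_lty; rewrite divr_gt0.
have ge0 : (0 <= \int[nu]_z (gprofile (a / 2) z)%:E)%E.
  by apply: integral_ge0 => z _; rewrite lee_fin gprofile_ge0.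
have k2 : 0 <= k ^- 2 by rewrite invr_ge0 exprn_ge0 ?(ltW k0).
exists (k ^- 2 * fine (\int[nu]_z (gprofile (a / 2) z)%:E)).
  by rewrite mulr_ge0 ?fine_ge0.
rewrite EFinM fineK ?ge0_fin_numE// -ge0_integralZl//; last 2 first.
- by apply/measurable_EFinP; exact: measurable_gprofile.
- by move=> z _; rewrite lee_fin gprofile_ge0.
apply: ge0_le_integral => //.
- by move=> z _; rewrite lee_fin mulr_ge0 ?sqr_ge0 ?gprofile_ge0.
- apply/measurable_EFinP; apply: measurable_funM.
    by apply: measurable_funX; exact: measurable_weight2.
  exact: measurable_gprofile.
- apply: emeasurable_funM => //; apply/measurable_EFinP; exact: measurable_gprofile.
- by move=> z _; rewrite -EFinM lee_fin bnd.
Qed.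

Lemma integral_form_gprofile_ge (b : R) (w : Y) s : 0 <= b ->
  (((8^-1 * expR (- b)) ^+ (d + K) * enorm w ^+ 2)%:E <=
   \int[nu]_z ((\sum_i w i 0 * z.2 i 0 + s) ^+ 2 * gprofile b z)%:E)%E.
Proof.
move=> b0; set k := 8^-1 * expR (- b).
have k0 : 0 <= k by rewrite mulr_ge0// expR_ge0.
pose f (y : Y) := (\sum_i w i 0 * y i 0 + s) ^+ 2.
have mf : measurable_fun setT f.
  by apply: measurable_funX; apply: measurable_funD => //; exact: measurable_linear_form.
have mg n : measurable_fun setT (fun x : 'cV[R]_n => expR (- b * enorm x ^+ 2)).
  exact: measurable_gauss (@measurable_enorm_sqr R n).
have mF : measurable_fun setT (fun z : U * Y => (f z.2 * gprofile b z)%:E).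
  apply/measurable_EFinP; apply: measurable_funM; last exact: measurable_gprofile.
  exact: measurableT_comp mf (@measurable_snd _ _ _ _).
rewrite fubini_tonelli1//; last first.
  by move=> z; rewrite lee_fin mulr_ge0 ?sqr_ge0 ?gprofile_ge0.
pose J : \bar R := (\int[lebesgue_cV R K]_y (f y * expR (- b * enorm y ^+ 2))%:E)%E.
have J0 : (0 <= J)%E.
  by apply: integral_ge0 => y _; rewrite lee_fin mulr_ge0 ?sqr_ge0 ?expR_ge0.
rewrite (eq_integral (fun u : U => (expR (- b * enorm u ^+ 2))%:E * J)%E); last first.
  move=> u _; rewrite /fubini_F /J -ge0_integralZl//.
  - by apply: eq_integral => y _; rewrite gprofileE mulrCA EFinM.
  - by apply/measurable_EFinP; exact: measurable_funM.
  - by move=> y _; rewrite lee_fin mulr_ge0 ?sqr_ge0 ?expR_ge0.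
rewrite ge0_integralZr//; last exact/measurable_EFinP.
rewrite exprD -mulrA EFinM; apply: lee_pmul.
- by rewrite lee_fin exprn_ge0.
- by rewrite lee_fin mulr_ge0 ?sqr_ge0 ?exprn_ge0.
- have := @integral_affine_form_sqr_ge R b d 0 1 b0.
  rewrite [enorm 0 ^+ 2]enorm_sqr big1 => [|i _]; last by rewrite mxE expr0n.
  rewrite add0r expr1n mulr1 => /le_trans; apply.
  rewrite le_eqVlt; apply/orP; left; apply/eqP/eq_integral => u _.
  by rewrite big1 ?add0r ?expr1n ?mul1r// => i _; rewrite mxE mul0r.
- apply: le_trans (integral_affine_form_sqr_ge _ _ b0).
  by rewrite lee_fin ler_wpM2l ?exprn_ge0// lerDl sqr_ge0.
Qed.

End ProductSpace.

(** * Moving an affine map from the test function into the density *)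

Section Transport.
Variables (R : realType) (d K : nat).
Local Notation U := 'cV[R]_d.
Local Notation Y := 'cV[R]_K.
Local Notation V := 'cV[R]_(d + K).
Local Notation nu := (lebesgue_cV R d \x lebesgue_cV R K)%E.

Definition affine_map (A : 'M[R]_(d, K)) (ydag : Y) (x : V) : U :=
  usubmx x + A *m (ydag - dsubmx x).

Lemma measurable_affine_map A ydag : measurable_fun setT (affine_map A ydag).
Proof.
apply: measurable_mxD; first exact: measurable_usubmx.
apply: measurable_mulmx; apply: measurable_mxB => //; exact: measurable_dsubmx.
Qed.

Lemma g_weight_affine_map (G ky : R) A ydag (x : V) :
  mxl1 A <= G -> enorm ydag <= ky ->
  g_weight (affine_map A ydag x) <= (2 + 4 * G ^+ 2 * (1 + ky ^+ 2)) * g_weight x.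
Proof.
move=> AG yk; rewrite /g_weight (enorm_usubmx x) /affine_map.
set u := usubmx x; set y := dsubmx x; set b := ydag - y.
have hb : enorm b ^+ 2 <= 2 * ky ^+ 2 + 2 * enorm y ^+ 2.
  apply: le_trans (enorm_sqrB _ _) _; rewrite lerD2r ler_wpM2l//.
  by rewrite lerXn2r ?nnegrE ?enorm_ge0// (le_trans _ yk) ?enorm_ge0.
have hAb : enorm (A *m b) ^+ 2 <= G ^+ 2 * enorm b ^+ 2.
  rewrite -exprMn lerXn2r ?nnegrE ?enorm_ge0//.
    by rewrite mulr_ge0 ?enorm_ge0// (le_trans _ AG)// mxl1_ge0.
  apply: le_trans (enorm_mulmx _ _) _; rewrite ler_wpM2r ?enorm_ge0//.
have h := enorm_sqrD u (A *m b).
have G2 := sqr_ge0 G; have k2 := sqr_ge0 ky.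
have u2 := sqr_ge0 (enorm u); have y2 := sqr_ge0 (enorm y).
have hG : G ^+ 2 * enorm b ^+ 2 <= G ^+ 2 * (2 * ky ^+ 2 + 2 * enorm y ^+ 2).
  exact: ler_wpM2l.
have e1 : 0 <= G ^+ 2 * enorm u ^+ 2 by exact: mulr_ge0.
have e2 : 0 <= G ^+ 2 * ky ^+ 2 by exact: mulr_ge0.
have e3 : 0 <= G ^+ 2 * ky ^+ 2 * enorm u ^+ 2 by exact: mulr_ge0.
have e4 : 0 <= G ^+ 2 * ky ^+ 2 * enorm y ^+ 2 by exact: mulr_ge0.
have e5 : 0 <= G ^+ 2 * enorm y ^+ 2 by exact: mulr_ge0.
lra.
Qed.

Definition has_density (p : {measure set V -> \bar R}) (rho : U * Y -> R) : Prop :=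
  forall F : V -> \bar R, measurable_fun setT F -> (forall x, 0 <= F x)%E ->
  (\int[p]_x F x = \int[nu]_z (F (pair_col z) * (rho z)%:E))%E.

(** Gaussian upper bound, and Lipschitz continuity in [u] with a Gaussian-decaying
    constant.  The analysis map translates [u] for fixed [y], hence only
    regularity in [u] matters. *)
Definition regular_density (a C L : R) (rho : U * Y -> R) : Prop :=
  [/\ measurable_fun setT rho, forall z, 0 <= rho z,
      forall z, rho z <= C * gprofile a z &
      forall u u' y, `|rho (u, y) - rho (u', y)| <=
        L * enorm (u - u') * (gprofile a (u, y) + gprofile a (u', y))].

Section fixed_observation.
Variables (a G ky M : R) (ydag : Y).
Hypothesis hy : enorm ydag <= ky.
Hypothesis hM :
  (\int[nu]_z (weight2 z ^+ 2 * gprofile a z)%:E <= M%:E)%E.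

Let C1 := 2 + 4 * G ^+ 2 * (1 + ky ^+ 2).
Let ky0 : 0 <= ky := le_trans (enorm_ge0 ydag) hy.
Let C1_ge0 : 0 <= C1.
Proof.
rewrite addr_ge0// mulr_ge0//; first by rewrite mulr_ge0 ?sqr_ge0.
by rewrite addr_ge0 ?sqr_ge0.
Qed.

Let drift (A : 'M[R]_(d, K)) (y : Y) : U := A *m (ydag - y).

Let mdrift A : measurable_fun setT (drift A).
Proof. by apply: measurable_mulmx; exact: measurable_mxB. Qed.

Let back A (z : U * Y) := shear (fun y => - drift A y) z.

Let mback A : measurable_fun setT (back A).
Proof. by apply: measurable_shear; exact: measurable_mxN. Qed.

Let backK A z : back A (shear (drift A) z) = z.
Proof. by case: z => u y; rewrite /back /shear /= addrK. Qed.

Let q (y : Y) : R := 1 + ky + enorm y ^+ 2.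

Let q_ge1 y : 1 <= q y.
Proof. by rewrite /q -addrA lerDl addr_ge0 ?sqr_ge0. Qed.

Let obs_le y : enorm (ydag - y) <= q y.
Proof.
apply: le_trans (enormB _ _) _; rewrite /q.
have := enorm_ge0 y; have := hy; have := sqr_ge0 (enorm y - 1).
by rewrite sqrrB1; lra.
Qed.

Let envelope A (z : U * Y) : R := g_weight z.1 * q z.2 * gprofile a (back A z).

Let envelope_ge0 A z : 0 <= envelope A z.
Proof.
by rewrite !mulr_ge0 ?g_weight_ge0 ?gprofile_ge0// (le_trans _ (q_ge1 _)).
Qed.

Let envelopeM A z c :
  c * envelope A z = g_weight z.1 * q z.2 * (c * gprofile a (back A z)).
Proof. by rewrite /envelope; ring. Qed.

Let envelopeD A A' z c : c * (envelope A z + envelope A' z) =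
  g_weight z.1 * (c * q z.2 * (gprofile a (back A z) + gprofile a (back A' z))).
Proof. by rewrite /envelope; ring. Qed.

Let menvelope A : measurable_fun setT (envelope A).
Proof.
apply: measurable_funM; last exact: measurableT_comp (@measurable_gprofile R d K a) (mback A).
apply: measurable_funM.
  exact: measurableT_comp (@measurable_g_weight R d) (@measurable_fst _ _ _ _).
apply: measurable_funD => //; apply: measurable_enorm_sqr_comp.
exact: measurable_snd.
Qed.

Let integral_envelope A : mxl1 A <= G ->
  (\int[nu]_z (envelope A z)%:E <= (C1 * (1 + ky) * M)%:E)%E.
Proof.
move=> AG; rewrite -(ge0_integral_shear (mdrift A)); last 2 first.
- exact/measurable_EFinP.
- by move=> z; rewrite lee_fin.
have cc : 0 <= C1 * (1 + ky) by rewrite mulr_ge0// addr_ge0.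
apply: (@le_trans _ _ (\int[nu]_z ((C1 * (1 + ky))%:E *
    (weight2 z ^+ 2 * gprofile a z)%:E))%E).
  have mw : measurable_fun setT (fun z : U * Y => weight2 z ^+ 2 * gprofile a z).
    apply: measurable_funM; last exact: measurable_gprofile.
    by apply: measurable_funX; exact: measurable_weight2.
  apply: ge0_le_integral => //.
  - by move=> z _; rewrite lee_fin.
  - apply/measurable_EFinP.
    exact: measurableT_comp (menvelope A) (measurable_shear (mdrift A)).
  - by apply: emeasurable_funM => //; exact/measurable_EFinP.
  - move=> z _; rewrite -EFinM lee_fin /envelope backK [leRHS]mulrA.
    rewrite ler_wpM2r ?gprofile_ge0//.
    have gw : g_weight (pair_col z) = weight2 z.
      by rewrite /g_weight /pair_col enorm_col_mx addrA.
    have h1 : g_weight (shear (drift A) z).1 <= C1 * weight2 z.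
      have := g_weight_affine_map (pair_col z) AG hy; rewrite gw.
      by rewrite /affine_map /pair_col col_mxKu col_mxKd.
    have h2 : q (shear (drift A) z).2 <= (1 + ky) * weight2 z.
      rewrite /q /shear /weight2 /=.
      have := sqr_ge0 (enorm z.1); have := sqr_ge0 (enorm z.2).
      have := ky0; nra.
    have -> : C1 * (1 + ky) * weight2 z ^+ 2 = (C1 * weight2 z) * ((1 + ky) * weight2 z).
      by ring.
    by apply: ler_pM => //; rewrite ?g_weight_ge0// (le_trans _ (q_ge1 _)).
rewrite ge0_integralZl//.
- by rewrite [leRHS]EFinM lee_wpmul2l ?lee_fin.
- apply/measurable_EFinP; apply: measurable_funM; last exact: measurable_gprofile.
  by apply: measurable_funX; exact: measurable_weight2.
- by move=> z _; rewrite lee_fin mulr_ge0 ?sqr_ge0 ?gprofile_ge0.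
Qed.

(** Substituting [u + A b] for [u], with [b = ydag - y], moves the map out of the
    merely measurable [f] and into the Lipschitz density. *)
Lemma integral_affine_map_diff (p : {measure set V -> \bar R}) (C L : R)
    (rho : U * Y -> R) (A A' : 'M[R]_(d, K)) (f : U -> R) :
  0 <= L -> regular_density a C L rho -> has_density p rho ->
  mxl1 A <= G -> mxl1 A' <= G -> measurable_fun setT f ->
  (forall u, `|f u| <= g_weight u) ->
  `|\int[p]_x f (affine_map A ydag x) - \int[p]_x f (affine_map A' ydag x)| <=
  L * (2 * (C1 * (1 + ky) * M)) * mxl1 (A - A').
Proof.
move=> L0 [mrho rho0 rhoC rhoL] prho AG A'G mf fg.
pose H B z := f z.1 * rho (back B z).
have mH B : measurable_fun setT (H B).
  apply: measurable_funM; last exact: measurableT_comp mrho (mback B).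
  exact: measurableT_comp mf (@measurable_fst _ _ _ _).
have HE B : (\int[p]_x (f (affine_map B ydag x))%:E = \int[nu]_z (H B z)%:E)%E.
  rewrite (integral_same_ge0 rho0 prho); last first.
    exact: measurableT_comp mf (measurable_affine_map _ _).
  rewrite -(integral_shear (mdrift B) (mH B)); apply: eq_integral => z _.
  by rewrite /H backK /affine_map /pair_col col_mxKu col_mxKd.
have iE B : mxl1 B <= G -> nu.-integrable setT (EFin \o envelope B).
  move=> BG; apply/integrableP; split; first exact/measurable_EFinP.
  under eq_integral do rewrite /= ger0_norm//.
  exact: le_lt_trans (integral_envelope BG) (ltry _).
have C0 : 0 <= C.
  have := le_trans (rho0 (0, 0)) (rhoC (0, 0)).
  by rewrite pmulr_lge0// expR_gt0.
have iH B : mxl1 B <= G -> nu.-integrable setT (EFin \o H B).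
  move=> BG; apply: (le_integrable measurableT _ _ (integrable_mulr C (iE B BG))).
    exact/measurable_EFinP.
  move=> z _; rewrite /= lee_fin normrM.
  have CE : 0 <= C * envelope B z by exact: mulr_ge0.
  rewrite [leRHS]ger0_norm// envelopeM.
  apply: ler_pM => //; last by rewrite ger0_norm.
  by apply: le_trans (fg _) _; rewrite ler_peMr ?g_weight_ge0.
have HR B : \int[p]_x f (affine_map B ydag x) = \int[nu]_z H B z.
  by congr fine; exact: HE.
rewrite !HR -RintegralB ?iH//.
have iD := integrable_addr (iH A AG) (integrable_mulr (-1) (iH A' A'G)).
have iHH : nu.-integrable setT (EFin \o (fun z => H A z - H A' z)).
  by move: iD; apply: eq_integrable => // z _; rewrite /= mulN1r.
apply: le_trans (le_normr_Rintegral measurableT iHH) _.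
set c := L * mxl1 (A - A').
have c0 : 0 <= c by rewrite mulr_ge0// mxl1_ge0.
have iEE := integrable_mulr c (integrable_addr (iE A AG) (iE A' A'G)).
apply: (@le_trans _ _ (\int[nu]_z (c * (envelope A z + envelope A' z)))).
  apply: le_Rintegral => //; first exact: integrable_norm.
  move=> z _; rewrite /H -mulrBr normrM.
  rewrite envelopeD.
  apply: ler_pM => //; apply: le_trans (rhoL _ _ _) _.
  rewrite ler_wpM2r ?addr_ge0 ?gprofile_ge0// /c -mulrA ler_wpM2l//.
  have -> : z.1 + - drift A z.2 - (z.1 + - drift A' z.2) =
      - ((A - A') *m (ydag - z.2)).
    by rewrite /drift mulmxBl opprD opprK addrACA subrr add0r opprB addrC.
  rewrite enormN; apply: le_trans (enorm_mulmx _ _) _.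
  by rewrite ler_wpM2l ?mxl1_ge0.
have IE B : mxl1 B <= G -> \int[nu]_z envelope B z <= C1 * (1 + ky) * M.
  move=> BG; rewrite -lee_fin fineK; last exact: integrable_fin_num (iE B BG).
  exact: integral_envelope.
rewrite RintegralZl ?RintegralD ?iE//; last exact: integrable_addr (iE A AG) (iE A' A'G).
have -> : L * (2 * (C1 * (1 + ky) * M)) * mxl1 (A - A') =
  c * (C1 * (1 + ky) * M + C1 * (1 + ky) * M) by rewrite /c; ring.
by rewrite ler_wpM2l// lerD ?IE.
Qed.

End fixed_observation.
End Transport.

(** * Moments of a measure with a regular density *)

Section AbstractTheorem.
Variables (R : realType) (d K : nat).
Local Notation U := 'cV[R]_d.
Local Notation Y := 'cV[R]_K.
Local Notation V := 'cV[R]_(d + K).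
Local Notation nu := (lebesgue_cV R d \x lebesgue_cV R K)%E.

Lemma qform_drsubmx (S : 'M[R]_(d + K)) (w : Y) :
  qform (drsubmx S) w = qform S (col_mx 0 w).
Proof.
rewrite [in RHS]/qform -[S in RHS]submxK tr_col_mx mul_row_block trmx0 !mul0mx !add0r.
by rewrite mul_row_col mulmx0 add0r.
Qed.

Lemma enorm_col0 (w : Y) : enorm (col_mx (0 : U) w) ^+ 2 = enorm w ^+ 2.
Proof.
rewrite enorm_col_mx [enorm 0 ^+ 2]enorm_sqr big1 ?add0r// => i _.
by rewrite mxE expr0n.
Qed.

Lemma coercive_drsubmx c (S : 'M[R]_(d + K)) :
  coercive c S -> coercive c (drsubmx S).
Proof. by move=> Sc w; rewrite qform_drsubmx -enorm_col0. Qed.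

Lemma coercive_le n c c' (S : 'M[R]_n) : c' <= c -> coercive c S -> coercive c' S.
Proof.
by move=> cc Sc v; apply: le_trans (Sc v); rewrite ler_wpM2r ?sqr_ge0.
Qed.

Section density_moments.
Variables (a C L M : R) (p : {measure set V -> \bar R}) (rho : U * Y -> R).
Hypotheses (hrho : regular_density a C L rho) (prho : has_density p rho).
Hypothesis hM :
  (\int[nu]_z (weight2 z ^+ 2 * gprofile a z)%:E <= M%:E)%E.

Let C0 : 0 <= C.
Proof.
have [_ rho0 rhoC _] := hrho; have := le_trans (rho0 (0, 0)) (rhoC (0, 0)).
by rewrite pmulr_lge0// expR_gt0.
Qed.

Let g_weight_pair_col (z : U * Y) : g_weight (pair_col z) = weight2 z.
Proof. by rewrite /g_weight /pair_col enorm_col_mx addrA. Qed.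

Lemma integral_g_weight_density :
  (\int[p]_x (g_weight x)%:E <= (C * M)%:E)%E.
Proof.
have [mrho rho0 rhoC _] := hrho.
rewrite prho; last 2 first.
- by apply/measurable_EFinP; exact: measurable_g_weight.
- by move=> x; rewrite lee_fin g_weight_ge0.
have mw : measurable_fun setT (fun z : U * Y => weight2 z ^+ 2 * gprofile a z).
  apply: measurable_funM; last exact: measurable_gprofile.
  by apply: measurable_funX; exact: measurable_weight2.
have w0 (z : U * Y) : 0 <= weight2 z by exact: le_trans (weight2_ge1 z).
apply: (@le_trans _ _ (\int[nu]_z (C%:E * (weight2 z ^+ 2 * gprofile a z)%:E))%E).
  apply: ge0_le_integral => //.
  - by move=> z _; rewrite -EFinM lee_fin mulr_ge0 ?g_weight_ge0.
  - apply: emeasurable_funM; apply/measurable_EFinP => //.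
    exact: measurableT_comp (@measurable_g_weight R _) (@measurable_pair_col R d K).
  - by apply: emeasurable_funM => //; exact/measurable_EFinP.
  - move=> z _; rewrite -!EFinM lee_fin g_weight_pair_col [leRHS]mulrCA.
    apply: ler_pM => //.
    by rewrite expr2 ler_peMr// weight2_ge1.
rewrite ge0_integralZl//.
- by rewrite [leRHS]EFinM lee_wpmul2l ?lee_fin.
- exact/measurable_EFinP.
- by move=> z _; rewrite lee_fin mulr_ge0 ?sqr_ge0 ?gprofile_ge0.
Qed.

Lemma integrable_g_weight_density : p.-integrable setT (EFin \o @g_weight R _).
Proof.
apply/integrableP; split.
  by apply/measurable_EFinP; exact: measurable_g_weight.
under eq_integral do rewrite /= ger0_norm ?g_weight_ge0//.
exact: le_lt_trans integral_g_weight_density (ltry _).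
Qed.

Lemma Rintegral_g_weight_density : \int[p]_x g_weight x <= C * M.
Proof.
rewrite -lee_fin fineK; first exact: integral_g_weight_density.
exact: integrable_fin_num integrable_g_weight_density.
Qed.

(** The quadratic form is the integral of the square of an affine function of [y];
    replacing the density by its Gaussian lower bound makes it smaller, and a
    nondegenerate Gaussian sees every direction. *)
Lemma cov_yy_density_coercive b c : 0 <= b -> 0 <= c ->
  (forall z, c * gprofile b z <= rho z) ->
  coercive (c * (8^-1 * expR (- b)) ^+ (d + K)) (cov_yy p).
Proof.
move=> b0 c0 hlow w; have [mrho rho0 _ _] := hrho.
have ip := integrable_g_weight_density.
rewrite /cov_yy qform_drsubmx qform_cov//.
(* The mean of the [u] block is killed by the zero block of the direction. *)
pose s := - \sum_i w i 0 * mean p (rshift d i) 0.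
rewrite -lee_fin fineK; last first.
  apply: integrable_fin_num => //; exact: integrable_sqr_centered_form.
have mF : measurable_fun setT (fun x : V =>
    ((\sum_i (col_mx 0 w : V) i 0 * (x i 0 - mean p i 0)) ^+ 2)%:E).
  apply/measurable_EFinP; apply: measurable_funX; apply: measurable_sum => i.
  by apply: measurable_funM => //; apply: measurable_funB => //; exact: measurable_mx_coord.
rewrite prho//; last by move=> x; rewrite lee_fin sqr_ge0.
have FE (z : U * Y) : \sum_i (col_mx 0 w : V) i 0 * (pair_col z i 0 - mean p i 0) =
    \sum_i w i 0 * z.2 i 0 + s.
  rewrite big_split_ord /= big1 ?add0r => [|i _]; last by rewrite col_mxEu mxE mul0r.
  rewrite /s -sumrB; apply: eq_bigr => i _.
  by rewrite /pair_col !col_mxEd mulrBr.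
have mf : measurable_fun setT (fun z : U * Y => (\sum_i w i 0 * z.2 i 0 + s) ^+ 2).
  apply: measurable_funX; apply: measurable_funD => //.
  exact: measurableT_comp (measurable_linear_form w) (@measurable_snd _ _ _ _).
apply: (@le_trans _ _ (\int[nu]_z (c%:E *
    ((\sum_i w i 0 * z.2 i 0 + s) ^+ 2 * gprofile b z)%:E))%E).
  rewrite ge0_integralZl//.
  - rewrite -mulrA EFinM lee_wpmul2l ?lee_fin//.
    exact: integral_form_gprofile_ge.
  - by apply/measurable_EFinP; apply: measurable_funM => //; exact: measurable_gprofile.
  - by move=> z _; rewrite lee_fin mulr_ge0 ?sqr_ge0 ?gprofile_ge0.
apply: ge0_le_integral => //.
- by move=> z _; rewrite -EFinM lee_fin mulr_ge0// mulr_ge0 ?sqr_ge0 ?gprofile_ge0.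
- apply: emeasurable_funM => //; apply/measurable_EFinP.
  by apply: measurable_funM => //; exact: measurable_gprofile.
- apply: emeasurable_funM; last exact/measurable_EFinP.
  exact: measurableT_comp mF (@measurable_pair_col R d K).
- move=> z _; rewrite -!EFinM lee_fin FE mulrCA.
  by rewrite ler_wpM2l ?sqr_ge0.
Qed.

End density_moments.
End AbstractTheorem.

(** * Lipschitz estimate against a measure with a regular density *)

Section AnalysisMapLipschitz.
Variables (R : realType) (d K : nat).
Local Notation U := 'cV[R]_d.
Local Notation Y := 'cV[R]_K.
Local Notation V := 'cV[R]_(d + K).

Lemma integral_T_op (m : {measure set V -> \bar R}) (G ky : R) (ydag : Y) (f : U -> R) :
  m.-integrable setT (EFin \o @g_weight R _) ->
  mxl1 (gain (cov m)) <= G -> enorm ydag <= ky ->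
  measurable_fun setT f -> (forall u, `|f u| <= g_weight u) ->
  m.-integrable setT (EFin \o (fun x => f (affine_map (gain (cov m)) ydag x))) /\
  (\int[T_op ydag m]_u (f u)%:E =
   (\int[m]_x f (affine_map (gain (cov m)) ydag x))%:E)%E.
Proof.
move=> im mG hy mf fg; set A := gain (cov m).
have mA := measurable_affine_map A ydag.
have iA : m.-integrable setT (EFin \o (fun x => f (affine_map A ydag x))).
  apply: (@integrable_le_weight _ _ _ im _ (2 + 4 * G ^+ 2 * (1 + ky ^+ 2))).
    exact: measurableT_comp mf mA.
  by move=> x; apply: le_trans (fg _) _; exact: g_weight_affine_map.
split=> //; rewrite -EFin_Rintegral//.
rewrite -[T_op ydag m]/(pushforward m (affine_map A ydag)) integral_pushforward//.
exact/measurable_EFinP.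
Qed.

Theorem dg_T_op_regular_density (a b c C L r ky : R) :
  0 < a -> 0 <= b -> 0 < c -> 0 <= L -> 1 <= r -> 0 <= ky ->
  exists LT : R, forall (rho : U * Y -> R) (p : {measure set V -> \bar R}),
    regular_density a C L rho -> (forall z, c * gprofile b z <= rho z) ->
    has_density p rho ->
    forall (pi : probability V R) (ydag : Y), in_PR r pi -> enorm ydag <= ky ->
    (dg (T_op ydag pi) (T_op ydag p) <= LT%:E * dg pi p)%E.
Proof.
move=> a0 b0 c0 L0 hr ky0.
have [M M0 hM] := @integral_weight2_gprofile R d K a a0.
pose Mp := C * M.
pose c1 := c * (8^-1 * expR (- b)) ^+ (d + K).
have c10 : 0 < c1 by rewrite mulr_gt0// exprn_gt0// mulr_gt0// expR_gt0.
have r0 : 0 < r by exact: lt_le_trans hr.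
pose c2 := Num.min c1 (r ^- 2).
have c20 : 0 < c2 by rewrite lt_min c10 invr_gt0 exprn_gt0.
pose Mc := Num.max (r ^+ 2) (Mp + Mp * Mp * (2 + Mp)).
pose G := (d%:R * K%:R * Mc) * (K%:R * K%:R * c2^-1).
pose G' := (d%:R * K%:R + (d%:R * K%:R * Mc) * (K%:R * K%:R * c2^-1) * (K%:R * K%:R))
    * (K%:R * K%:R * c2^-1) : R.
pose e := 1 + r + Mp + Mp * Mp.
pose C1 := 2 + 4 * G ^+ 2 * (1 + ky ^+ 2).
have C10 : 0 < C1.
  apply: (@lt_le_trans _ _ 2) => //; rewrite lerDl mulr_ge0 ?addr_ge0 ?sqr_ge0//.
  by rewrite mulr_ge0 ?sqr_ge0.
pose L2 := L * (2 * (C1 * (1 + ky) * M)).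
have ky1 : 0 <= 1 + ky by rewrite addr_ge0.
have L20 : 0 <= L2 by do ?apply: mulr_ge0 => //; exact: ltW.
(* [C1] controls the first term of the splitting, [L2 * (G' * e)] the second. *)
exists (C1 + `|L2 * (G' * e)|) => rho p hrho hlow prho pi ydag hpi hy.
have LT0 : 0 < C1 + `|L2 * (G' * e)| by apply: lt_le_trans C10 _; rewrite lerDl.
have [->|dfin] := eqVneq (dg pi p) +oo%E; first by rewrite gt0_muley ?lte_fin// leey.
have {dfin} [D dE] : exists D, dg pi p = D%:E.
  by move: dfin (dg_ge0 pi p); case: (dg pi p) => // D _ _; exists D.
have D0 : 0 <= D by rewrite -lee_fin -dE dg_ge0.
have ip := integrable_g_weight_density hrho prho hM.
have ipi : pi.-integrable setT (EFin \o @g_weight R (d + K)).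
  by have [h _ _ _] := hpi; exact: integrable_g_weight.
have piD (f : V -> R) (mf : measurable_fun setT f) (fg : forall x, `|f x| <= g_weight x) :
    `|\int[pi]_x f x - \int[p]_x f x| <= D.
  by apply: dg_Rintegral => //; rewrite dE.
have pMp := Rintegral_g_weight_density hrho prho hM.
have cpi : coercive c2 (drsubmx (cov pi)).
  apply: coercive_drsubmx; apply: coercive_le (cov_PR_coercive hpi).
  by rewrite ge_min lexx orbT.
have cp : coercive c2 (drsubmx (cov p)).
  apply: coercive_le (cov_yy_density_coercive hrho prho hM b0 (ltW c0) hlow).
  by rewrite ge_min lexx.
have Mpi i j : `|cov pi i j| <= Mc.
  by apply: le_trans (cov_PR_le hr hpi i j) _; rewrite le_max lexx.
have Mcp i j : `|cov p i j| <= Mc.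
  by apply: le_trans (cov_le ip pMp i j) _; rewrite le_max lexx orbT.
have Gpi : mxl1 (gain (cov pi)) <= G by exact: mxl1_gain.
have Gp : mxl1 (gain (cov p)) <= G by exact: mxl1_gain.
have GB : mxl1 (gain (cov pi) - gain (cov p)) <= G' * (e * D).
  by apply: mxl1_gainB => // i j; exact: cov_stable.
rewrite dE -EFinM; apply: ub_ereal_sup => _ [f [mf fg] <-].
have [iTpi ->] := integral_T_op ipi Gpi hy mf fg.
have [iTp ->] := integral_T_op ip Gp hy mf fg.
rewrite -EFinB abse_EFin lee_fin.
set Tpi := affine_map (gain (cov pi)) ydag.
rewrite -(subrKA (\int[p]_x f (Tpi x))) mulrDl.
apply: le_trans (ler_normD _ _) _; apply: lerD.
  (* Dividing by [C1] makes the composition an admissible test function. *)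
  pose f1 x := C1^-1 * f (Tpi x).
  have mfT : measurable_fun setT (fun x => f (Tpi x)).
    exact: measurableT_comp mf (measurable_affine_map _ _).
  have f1g x : `|f1 x| <= g_weight x.
    rewrite normrM gtr0_norm ?invr_gt0// ler_pdivrMl//.
    by apply: le_trans (fg _) _; exact: g_weight_affine_map.
  have := piD f1 (measurable_funM (measurable_cst _) mfT) f1g.
  have iTpip : p.-integrable setT (EFin \o (fun x => f (Tpi x))).
    apply: (@integrable_le_weight _ _ _ ip _ C1) => // x.
    by apply: le_trans (fg _) _; exact: g_weight_affine_map.
  rewrite /f1 !RintegralZl// -mulrBr normrM gtr0_norm ?invr_gt0//.
  by rewrite ler_pdivrMl.
have := integral_affine_map_diff hy hM L0 hrho prho Gpi Gp mf fg.
move=> /le_trans; apply; rewrite -/C1 -/L2.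
apply: (@le_trans _ _ (L2 * (G' * (e * D)))); first by rewrite ler_wpM2l.
by rewrite !mulrA ler_wpM2r// -!mulrA ler_norm.
Qed.

End AnalysisMapLipschitz.

(** * Gaussian kernels *)

Section GaussianKernel.
Variable R : realType.

(** The derivative of [exp (- s^2 / 4)] is bounded by [1].  The inequality
    [1 + x <= exp x] suffices: for [s - t >= 1] the claim is trivial, and otherwise
    use [s^2 - t^2 = (s - t) ((s - t) + 2 t)] and [t exp (- t^2 / 4) <= 1]. *)
Lemma expR_quarter_sqr_lipschitz (s t : R) : 0 <= s -> 0 <= t ->
  `|expR (- (s ^+ 2 / 4)) - expR (- (t ^+ 2 / 4))| <= `|s - t|.
Proof.
wlog ts : s t / t <= s => [H s0 t0|s0 t0].
  have [ts|/ltW st] := leP t s; first exact: H.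
  by rewrite distrC [leRHS]distrC; exact: H.
set Es := expR (- (s ^+ 2 / 4)); set Et := expR (- (t ^+ 2 / 4)).
have EsE : Es <= Et by rewrite ler_expR lerN2; nra.
rewrite distrC ger0_norm ?subr_ge0// [leRHS]ger0_norm ?subr_ge0//.
have Et0 : 0 <= Et by exact: expR_ge0.
have Es0 : 0 <= Es by exact: expR_ge0.
have Et1 : Et <= 1 by rewrite -expR0 ler_expR oppr_le0; nra.
have [st1|st1] := leP 1 (s - t); first by lra.
have step : Et - Es <= Et * ((s - t) * (s + t) / 4).
  have -> : Es = Et * expR (- ((s - t) * (s + t) / 4)).
    by rewrite -expRD; congr expR; field.
  have := expR_ge1Dx (- ((s - t) * (s + t) / 4)).
  move=> h; rewrite -[X in X - _]mulr1 -mulrBr ler_wpM2l//; lra.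
have tEt : t * Et <= 1.
  have : Et * expR (t ^+ 2 / 4) = 1 by rewrite -expRD addNr expR0.
  have := expR_ge1Dx (t ^+ 2 / 4); have := sqr_ge0 (t - 2); nra.
apply: le_trans step _.
have -> : Et * ((s - t) * (s + t) / 4) = (s - t) * ((Et * (s - t) + 2 * (t * Et)) / 4).
  by field.
have h : Et * (s - t) <= 1 by rewrite mulr_ile1// ?subr_ge0// ltW.
by rewrite -[leRHS]mulr1 ler_wpM2l ?subr_ge0//; lra.
Qed.

(** As [exp (- s^2 / 2)] is the square of [exp (- s^2 / 4)], the factorisation of a
    difference of squares leaves a decaying factor beside the Lipschitz one. *)
Lemma expR_half_sqr_lipschitz (s t : R) : 0 <= s -> 0 <= t ->
  `|expR (- 2^-1 * s ^+ 2) - expR (- 2^-1 * t ^+ 2)| <=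
  `|s - t| * (expR (- (s ^+ 2 / 4)) + expR (- (t ^+ 2 / 4))).
Proof.
move=> s0 t0.
have E x : expR (- 2^-1 * x ^+ 2) = expR (- (x ^+ 2 / 4)) ^+ 2 :> R.
  by rewrite -expRM_natl; congr expR; field.
rewrite !E subr_sqr normrM [X in _ * X <= _]ger0_norm ?addr_ge0 ?expR_ge0//.
by rewrite ler_wpM2r ?addr_ge0 ?expR_ge0// expR_quarter_sqr_lipschitz.
Qed.

Lemma enorm_lipschitz n (x y : 'cV[R]_n) : `|enorm x - enorm y| <= enorm (x - y).
Proof.
have h1 := enormD (y - x) x; have h2 := enormD (x - y) y; move: h1 h2.
rewrite !subrK -(enormN (y - x)) opprB ler_norml => h1 h2.
by apply/andP; split; lra.
Qed.

Definition whiten n (S : 'M[R]_n) : 'M[R]_n := invmx (sqrtmx S).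

Lemma enorm_le_whiten n (S : 'M[R]_n) v : spdmx S ->
  enorm v <= (1 + mxl1 (sqrtmx S)) * wnorm S v.
Proof.
move=> hS; have e : v = sqrtmx S *m (whiten S *m v) by rewrite mulKVmx ?sqrtmx_unit.
rewrite [in leLHS]e; apply: le_trans (enorm_mulmx _ _) _.
by rewrite ler_wpM2r ?enorm_ge0// lerDr.
Qed.

Lemma wnorm_le n (S : 'M[R]_n) v : wnorm S v <= mxl1 (whiten S) * enorm v.
Proof. exact: enorm_mulmx. Qed.

Lemma wnorm_ge0 n (S : 'M[R]_n) v : 0 <= wnorm S v.
Proof. exact: enorm_ge0. Qed.

(** The weighted norm is equivalent to the Euclidean one, and a bounded shift costs
    only an additive constant in the square. *)
Lemma wnorm_shift_bounds n (S : 'M[R]_n) (k : R) : spdmx S -> 0 <= k ->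
  exists al be ga : R, [/\ 0 < al, 0 <= be, 0 <= ga &
    forall v w, enorm w <= k ->
      al * enorm v ^+ 2 - ga <= wnorm S (v - w) ^+ 2 <= be * enorm v ^+ 2 + ga].
Proof.
move=> hS k0; pose b := 1 + mxl1 (sqrtmx S); pose m := mxl1 (whiten S).
have b0 : 0 < b by rewrite ltr_pwDl// mxl1_ge0.
have m0 : 0 <= m by exact: mxl1_ge0.
have b2 : 0 < b ^+ 2 by rewrite exprn_gt0.
exists (b ^- 2 / 2), (2 * m ^+ 2), (b ^- 2 * k ^+ 2 + 2 * m ^+ 2 * k ^+ 2); split.
- by rewrite divr_gt0// invr_gt0.
- by rewrite mulr_ge0 ?sqr_ge0.
- by apply: addr_ge0; apply: mulr_ge0; rewrite ?sqr_ge0 ?invr_ge0 ?sqr_ge0// mulr_ge0 ?sqr_ge0.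
move=> v w wk.
have wk2 : enorm w ^+ 2 <= k ^+ 2 by rewrite lerXn2r ?nnegrE ?enorm_ge0.
have h1 : b ^- 2 * enorm (v - w) ^+ 2 <= wnorm S (v - w) ^+ 2.
  rewrite ler_pdivrMl// -exprMn lerXn2r ?nnegrE ?enorm_ge0 ?mulr_ge0 ?wnorm_ge0 ?(ltW b0)//.
  exact: enorm_le_whiten.
have h2 : wnorm S (v - w) ^+ 2 <= m ^+ 2 * enorm (v - w) ^+ 2.
  rewrite -exprMn lerXn2r ?nnegrE ?wnorm_ge0 ?mulr_ge0 ?enorm_ge0//; exact: wnorm_le.
have h3 := enorm_sqrB v w.
have h4 : enorm v ^+ 2 <= 2 * enorm (v - w) ^+ 2 + 2 * enorm w ^+ 2.
  by have := enorm_sqrD (v - w) w; rewrite subrK.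
have ib : 0 <= b ^- 2 by rewrite invr_ge0 ltW.
have m2 := sqr_ge0 m.
apply/andP; split.
  apply: le_trans h1.
  have : b ^- 2 * enorm v ^+ 2 <= b ^- 2 * (2 * enorm (v - w) ^+ 2 + 2 * k ^+ 2).
    by rewrite ler_wpM2l//; lra.
  have : 0 <= 2 * m ^+ 2 * k ^+ 2 by rewrite mulr_ge0 ?mulr_ge0 ?sqr_ge0.
  lra.
apply: le_trans h2 _.
have : m ^+ 2 * enorm (v - w) ^+ 2 <= m ^+ 2 * (2 * enorm v ^+ 2 + 2 * k ^+ 2).
  by rewrite ler_wpM2l//; lra.
have : 0 <= b ^- 2 * k ^+ 2 by rewrite mulr_ge0 ?sqr_ge0.
lra.
Qed.

Lemma gauss_const_gt0 n (S : 'M[R]_n) : spdmx S -> 0 < gauss_const S.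
Proof.
move=> hS; rewrite invr_gt0 sqrtr_gt0 mulr_gt0 ?exprn_gt0 ?mulr_gt0 ?pi_gt0//.
have [_ <-] : psdmx (sqrtmx S) /\ sqrtmx S *m sqrtmx S = S.
  have [B hB] := spdmx_sqrt_exists hS.
  by rewrite /sqrtmx; case: xgetP => [_ -> //|/(_ B hB)].
rewrite det_mulmx -expr2 lt_neqAle sqr_ge0 andbT eq_sym sqrf_eq0.
by have := sqrtmx_unit hS; rewrite unitmxE unitfE.
Qed.

End GaussianKernel.

(** * The density of the forecast of state and observation *)

Section ForecastDensity.
Variables (R : realType) (d K : nat).
Local Notation U := 'cV[R]_d.
Local Notation Y := 'cV[R]_K.
Local Notation V := 'cV[R]_(d + K).
Local Notation nu := (lebesgue_cV R d \x lebesgue_cV R K)%E.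

Variables (Sigma : 'M[R]_d) (Gamma : 'M[R]_K).
Hypotheses (hSigma : spdmx Sigma) (hGamma : spdmx Gamma).

Lemma measurable_wnorm_sqr d' (T : measurableType d') n (S : 'M[R]_n) (f : T -> 'cV[R]_n) :
  measurable_fun setT f -> measurable_fun setT (fun t => wnorm S (f t) ^+ 2).
Proof.
by move=> mf; apply: measurable_enorm_sqr_comp; exact: measurable_mulmx.
Qed.

Section fixed_model.
Variables (Psi : U -> U) (h : U -> Y) (mu : probability U R).
Hypotheses (mPsi : measurable_fun setT Psi) (mh : measurable_fun setT h).

Definition state_kernel (u v : U) : R := expR (- 2^-1 * wnorm Sigma (u - Psi v) ^+ 2).

Definition obs_kernel (z : U * Y) : R := expR (- 2^-1 * wnorm Gamma (z.2 - h z.1) ^+ 2).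

Definition forecast_density (u : U) : R :=
  gauss_const Sigma * \int[mu]_v state_kernel u v.

Definition joint_density (z : U * Y) : R :=
  forecast_density z.1 * (gauss_const Gamma * obs_kernel z).

Let gS : 0 < gauss_const Sigma := gauss_const_gt0 hSigma.
Let gG : 0 < gauss_const Gamma := gauss_const_gt0 hGamma.

Lemma measurable_state_kernel : measurable_fun setT (fun z : U * U => state_kernel z.1 z.2).
Proof.
apply: measurable_gauss; apply: measurable_wnorm_sqr.
apply: measurable_mxB; first exact: measurable_fst.
exact: measurableT_comp mPsi (@measurable_snd _ _ _ _).
Qed.

Lemma measurable_obs_kernel : measurable_fun setT obs_kernel.
Proof.
apply: measurable_gauss; apply: measurable_wnorm_sqr.
apply: measurable_mxB; first exact: measurable_snd.
exact: measurableT_comp mh (@measurable_fst _ _ _ _).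
Qed.

Lemma measurable_state_kernelr u : measurable_fun setT (state_kernel u).
Proof.
by apply: measurable_gauss; apply: measurable_wnorm_sqr; exact: measurable_mxB.
Qed.

Lemma integrable_state_kernel u : mu.-integrable setT (EFin \o state_kernel u).
Proof.
have h1 : mu.-integrable setT (EFin \o (fun _ : U => 1)).
  exact: finite_measure_integrable_cst.
apply: (le_integrable measurableT _ _ h1).
  by apply/measurable_EFinP; exact: measurable_state_kernelr.
move=> v _; rewrite /= lee_fin ger0_norm ?expR_ge0// normr1 -expR0 ler_expR.
by rewrite mulNr oppr_le0 mulr_ge0 ?sqr_ge0.
Qed.

Lemma forecast_density_ge0 u : 0 <= forecast_density u.
Proof.
by rewrite mulr_ge0 ?(ltW gS)//; apply: Rintegral_ge0 => v _; exact: expR_ge0.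
Qed.

Lemma joint_density_ge0 z : 0 <= joint_density z.
Proof.
apply: mulr_ge0; first exact: forecast_density_ge0.
by apply: mulr_ge0; [exact: ltW|exact: expR_ge0].
Qed.

Lemma P_densityE u : P_density Sigma Psi mu u = (forecast_density u)%:E.
Proof.
rewrite /P_density /forecast_density EFinM fineK//.
by apply: integrable_fin_num => //; exact: integrable_state_kernel.
Qed.

Lemma measurable_forecast_density : measurable_fun setT forecast_density.
Proof.
apply: measurable_funM => //; apply/measurable_EFinP.
have -> : EFin \o (fun u => \int[mu]_v state_kernel u v) =
    fubini_F mu (fun z : U * U => (state_kernel z.1 z.2)%:E).
  apply/funext => u; rewrite /fubini_F /= fineK//.
  by apply: integrable_fin_num => //; exact: integrable_state_kernel.
apply: measurable_fun_fubini_tonelli_F.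
  by apply/measurable_EFinP; exact: measurable_state_kernel.
by move=> z; rewrite lee_fin expR_ge0.
Qed.

Lemma measurable_joint_density : measurable_fun setT joint_density.
Proof.
apply: measurable_funM.
  exact: measurableT_comp measurable_forecast_density (@measurable_fst _ _ _ _).
by apply: measurable_funM => //; exact: measurable_obs_kernel.
Qed.

(** Both operators integrate a kernel against Lebesgue measure, so by Tonelli their
    composition has the product of the kernels as density on the product space. *)
Lemma Q_P_has_density : exists p : {measure set V -> \bar R},
  eq_on_measurable (Q_op Gamma h (P_op Sigma Psi mu)) p /\
  has_density p joint_density.
Proof.
have [m0 m0E] := density_measure_is_measure (lebesgue_cV R d)
  measurable_forecast_density forecast_density_ge0.
have PE : P_op Sigma Psi mu = m0.
  rewrite m0E; apply/funext => A; apply: eq_integral => u _; exact: P_densityE.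
have [m1 m1E] := density_measure_is_measure nu measurable_joint_density joint_density_ge0.
have [p pE] := pushforward_is_measure m1 (@measurable_pair_col R d K).
exists p; split=> [C mC|F mF F0].
  rewrite PE pE /Q_op /pushforward m1E /density_measure.
  have mind : measurable_fun setT (fun z : U * Y => \1_C (pair_col z) : R).
    exact: measurableT_comp (measurable_indic mC) (@measurable_pair_col R d K).
  pose J (z : U * Y) : \bar R :=
    (\1_C (pair_col z) * (gauss_const Gamma * obs_kernel z))%:E.
  have mJ : measurable_fun setT J.
    apply/measurable_EFinP; apply: measurable_funM => //.
    by apply: measurable_funM => //; exact: measurable_obs_kernel.
  have J0 z : (0 <= J z)%E.
    by rewrite lee_fin !mulr_ge0 ?expR_ge0// ltW.
  transitivity (\int[m0]_u fubini_F (lebesgue_cV R K) J u)%E.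
    apply: eq_integral => u _; rewrite integral_mkcond /fubini_F.
    apply: eq_integral => y _; rewrite patchE /J indicE.
    have -> : (y \in [set y | C (col_mx u y)]) = (pair_col (u, y) \in C).
      by apply/idP/idP; rewrite !inE.
    by case: ifPn => _; rewrite ?mul1r ?mul0r.
  pose F2 (z : U * Y) : \bar R := (\1_C (pair_col z) * joint_density z)%:E.
  have F2E z : F2 z = ((forecast_density z.1)%:E * J z)%E.
    by rewrite /F2 /J -EFinM mulrCA.
  have mF2 : measurable_fun setT F2.
    apply/measurable_EFinP; apply: measurable_funM => //.
    exact: measurable_joint_density.
  have F20 z : (0 <= F2 z)%E by rewrite lee_fin mulr_ge0 ?joint_density_ge0.
  have mFJ : measurable_fun setT (fubini_F (lebesgue_cV R K) J).
    exact: measurable_fun_fubini_tonelli_F.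
  have FJ0 u : (0 <= fubini_F (lebesgue_cV R K) J u)%E by exact: integral_ge0.
  have m0D : eq_on_measurable m0 (density_measure (lebesgue_cV R d) forecast_density).
    by move=> A _; rewrite m0E.
  rewrite (ge0_integral_density measurable_forecast_density forecast_density_ge0 m0D)//.
  transitivity (\int[nu]_z F2 z)%E.
    rewrite fubini_tonelli1//; apply: eq_integral => u _.
    have mJu : measurable_fun setT (fun y : Y => J (u, y)).
      by apply: measurableT_comp mJ _; exact: measurable_fun_pair.
    have fu0 : (0 <= (forecast_density u)%:E)%E by rewrite lee_fin forecast_density_ge0.
    rewrite muleC; transitivity
        (\int[lebesgue_cV R K]_y ((forecast_density u)%:E * J (u, y)))%E.
      exact/esym/(ge0_integralZl _ measurableT mJu (fun y _ => J0 (u, y)) fu0).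
    by apply: eq_integral => y _; rewrite F2E.
  rewrite [RHS]integral_mkcond; apply: eq_integral => z _.
  rewrite patchE /F2 indicE.
  have -> : (z \in @pair_col R d K @^-1` C) = (pair_col z \in C).
    by apply/idP/idP; rewrite !inE.
  by case: ifPn => _; rewrite ?mul1r ?mul0r.
rewrite pE ge0_integral_pushforward//; last exact: measurable_pair_col.
rewrite preimage_setT.
have m1D : eq_on_measurable m1 (density_measure nu joint_density).
  by move=> A _; rewrite m1E.
have mFc : measurable_fun setT (fun z : U * Y => F (pair_col z)).
  exact: measurableT_comp mF (@measurable_pair_col R d K).
exact: (ge0_integral_density measurable_joint_density joint_density_ge0 m1D mFc).
Qed.

End fixed_model.
End ForecastDensity.

(** * Regularity of the forecast density *)

Section ProbabilityBounds.
Context d (T : measurableType d) (R : realType) (mu : probability T R).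
Implicit Types f g : T -> R.

Lemma Rintegral_prob_cst (c : R) : \int[mu]_x c = c.
Proof.
by rewrite Rintegral_cst// (_ : _ setT = 1%E) ?mulr1//; exact: probability_setT.
Qed.

Lemma integrable_prob_cst (c : R) : mu.-integrable setT (EFin \o (fun _ : T => c)).
Proof. exact: finite_measure_integrable_cst. Qed.

Lemma Rintegral_prob_le f B : mu.-integrable setT (EFin \o f) ->
  (forall x, f x <= B) -> \int[mu]_x f x <= B.
Proof.
move=> hf fB; rewrite -[leRHS]Rintegral_prob_cst.
by apply: le_Rintegral => //; exact: integrable_prob_cst.
Qed.

Lemma Rintegral_prob_ge f B : mu.-integrable setT (EFin \o f) ->
  (forall x, B <= f x) -> B <= \int[mu]_x f x.
Proof.
move=> hf fB; rewrite -[leLHS]Rintegral_prob_cst.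
by apply: le_Rintegral => //; exact: integrable_prob_cst.
Qed.

Lemma Rintegral_prob_dist f g B : mu.-integrable setT (EFin \o f) ->
  mu.-integrable setT (EFin \o g) -> (forall x, `|f x - g x| <= B) ->
  `|\int[mu]_x f x - \int[mu]_x g x| <= B.
Proof.
move=> hf hg fgB; rewrite -RintegralB//.
have hfg : mu.-integrable setT (EFin \o (fun x => f x - g x)).
  by have := integrableB measurableT hf hg; apply: eq_integrable => // x _.
apply: le_trans (le_normr_Rintegral measurableT hfg) _.
by apply: Rintegral_prob_le => //; exact: integrable_norm.
Qed.

End ProbabilityBounds.

Section DensityEstimates.
Variables (R : realType) (d K : nat).
Local Notation U := 'cV[R]_d.
Local Notation Y := 'cV[R]_K.
Local Notation V := 'cV[R]_(d + K).

Variables (Sigma : 'M[R]_d) (Gamma : 'M[R]_K) (kPsi kh lh : R).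
Hypotheses (hSigma : spdmx Sigma) (hGamma : spdmx Gamma).
Hypotheses (kPsi0 : 0 <= kPsi) (kh0 : 0 <= kh) (lh0 : 0 <= lh).

(** The whitened innovations: half of the squared norm is the exponent of the joint
    density, conditionally on the previous state [v]. *)
Definition residual (Psi : U -> U) (h : U -> Y) (z : U * Y) (v : U) : V :=
  col_mx (whiten Sigma *m (z.1 - Psi v)) (whiten Gamma *m (z.2 - h z.1)).

Lemma enorm_residual Psi h z v : enorm (residual Psi h z v) ^+ 2 =
  wnorm Sigma (z.1 - Psi v) ^+ 2 + wnorm Gamma (z.2 - h z.1) ^+ 2.
Proof. exact: enorm_col_mx. Qed.

Lemma residual_lipschitz Psi h u u' y v :
  (forall u v, enorm (h u - h v) <= lh * enorm (u - v)) ->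
  enorm (residual Psi h (u, y) v - residual Psi h (u', y) v) <=
  (mxl1 (whiten Sigma) + mxl1 (whiten Gamma) * lh) * enorm (u - u').
Proof.
move=> hlip; rewrite /residual opp_col_mx add_col_mx -!mulmxBr /=.
rewrite opprB addrA subrK opprB [y - h u + _]addrC addrA subrK.
set m := mxl1 (whiten Sigma); set n := mxl1 (whiten Gamma).
have m0 : 0 <= m by exact: mxl1_ge0.
have n0 : 0 <= n by exact: mxl1_ge0.
have e0 := enorm_ge0 (u - u').
have rhs0 : 0 <= (m + n * lh) * enorm (u - u').
  by rewrite mulr_ge0// addr_ge0// mulr_ge0.
rewrite -ler_sqr ?nnegrE ?enorm_ge0// enorm_col_mx.
have h1 : enorm (whiten Sigma *m (u - u')) <= m * enorm (u - u').
  exact: enorm_mulmx.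
have h2 : enorm (whiten Gamma *m (h u' - h u)) <= n * lh * enorm (u - u').
  apply: le_trans (enorm_mulmx _ _) _; rewrite -mulrA ler_wpM2l//.
  by rewrite -enormN opprB hlip.
have n1 : 0 <= n * lh * enorm (u - u') by rewrite mulr_ge0// mulr_ge0.
have n2 : 0 <= m * enorm (u - u') by rewrite mulr_ge0.
have s1 : enorm (whiten Sigma *m (u - u')) ^+ 2 <= (m * enorm (u - u')) ^+ 2.
  by rewrite ler_sqr ?nnegrE ?enorm_ge0.
have s2 : enorm (whiten Gamma *m (h u' - h u)) ^+ 2 <= (n * lh * enorm (u - u')) ^+ 2.
  by rewrite ler_sqr ?nnegrE ?enorm_ge0.
have := mulr_ge0 n1 n2; rewrite mulrDl sqrrD; lra.
Qed.

Lemma joint_density_residual Psi h (mu : probability U R) z :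
  measurable_fun setT Psi ->
  joint_density Sigma Gamma Psi h mu z =
  gauss_const Sigma * gauss_const Gamma *
    \int[mu]_v expR (- 2^-1 * enorm (residual Psi h z v) ^+ 2).
Proof.
move=> mPsi; rewrite /joint_density /forecast_density mulrACA; congr (_ * _).
rewrite -RintegralZr//; last exact: integrable_state_kernel.
by apply: eq_Rintegral => v _; rewrite enorm_residual mulrDr expRD.
Qed.

(** All estimates hold for the integrand uniformly in the previous state, with the
    squared norm of the residual playing the role of [|(u, y)|^2] up to constants;
    averaging over [mu] preserves them. *)
Lemma joint_density_bounds :
  exists a b c C L : R, [/\ 0 < a, 0 <= b, 0 < c, 0 <= L &
    forall (Psi : U -> U) (h : U -> Y) (mu : probability U R),
    measurable_fun setT Psi -> measurable_fun setT h ->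
    (forall v, enorm (Psi v) <= kPsi) -> (forall v, enorm (h v) <= kh) ->
    (forall u v, enorm (h u - h v) <= lh * enorm (u - v)) ->
    regular_density a C L (joint_density Sigma Gamma Psi h mu) /\
    forall z, c * gprofile b z <= joint_density Sigma Gamma Psi h mu z].
Proof.
have [al1 [be1 [ga1 [al10 be10 ga10 b1]]]] := wnorm_shift_bounds hSigma kPsi0.
have [al2 [be2 [ga2 [al20 be20 ga20 b2]]]] := wnorm_shift_bounds hGamma kh0.
pose al := Num.min al1 al2; pose be := be1 + be2; pose ga := ga1 + ga2.
pose gg := gauss_const Sigma * gauss_const Gamma.
have gg0 : 0 < gg by rewrite mulr_gt0 ?gauss_const_gt0.
have al0 : 0 < al by rewrite lt_min al10.
pose lip := mxl1 (whiten Sigma) + mxl1 (whiten Gamma) * lh.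
have lip0 : 0 <= lip by rewrite addr_ge0 ?mulr_ge0 ?mxl1_ge0.
exists (al / 4), (be / 2), (gg * expR (- (ga / 2))), (gg * expR (ga / 4)),
  (gg * lip * expR (ga / 4)); split.
- by rewrite divr_gt0.
- by rewrite divr_ge0// addr_ge0.
- by rewrite mulr_gt0// expR_gt0.
- by apply: mulr_ge0; [apply: mulr_ge0 => //; exact: ltW|exact: expR_ge0].
move=> Psi h mu mPsi mh Psik hk hlip.
pose q z v := enorm (residual Psi h z v) ^+ 2.
have qbnd z v : al * (enorm z.1 ^+ 2 + enorm z.2 ^+ 2) - ga <= q z v <=
    be * (enorm z.1 ^+ 2 + enorm z.2 ^+ 2) + ga.
  rewrite /q enorm_residual.
  have /andP[l1 u1] := b1 z.1 (Psi v) (Psik v).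
  have /andP[l2 u2] := b2 z.2 (h z.1) (hk z.1).
  have a1 : al * enorm z.1 ^+ 2 <= al1 * enorm z.1 ^+ 2.
    by rewrite ler_wpM2r ?sqr_ge0// ge_min lexx.
  have a2 : al * enorm z.2 ^+ 2 <= al2 * enorm z.2 ^+ 2.
    by rewrite ler_wpM2r ?sqr_ge0// ge_min lexx orbT.
  have c1 : 0 <= be2 * enorm z.1 ^+ 2 by rewrite mulr_ge0 ?sqr_ge0.
  have c2 : 0 <= be1 * enorm z.2 ^+ 2 by rewrite mulr_ge0 ?sqr_ge0.
  by rewrite /be /ga; apply/andP; split; lra.
have quarter z v : expR (- (q z v / 4)) <= expR (ga / 4) * gprofile (al / 4) z.
  have /andP[l _] := qbnd z v.
  by rewrite -expRD ler_expR; lra.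
have half z v : expR (- 2^-1 * q z v) <= expR (- (q z v / 4)).
  by rewrite ler_expR; have := sqr_ge0 (enorm (residual Psi h z v)); rewrite -/(q z v); lra.
have iq z : mu.-integrable setT (EFin \o (fun v => expR (- 2^-1 * q z v))).
  have := integrable_mulr (obs_kernel Gamma h z) (integrable_state_kernel Sigma mu mPsi z.1).
  apply: eq_integrable => // v _; congr EFin.
  by rewrite /q enorm_residual mulrDr expRD mulrC.
have E z : joint_density Sigma Gamma Psi h mu z = gg * \int[mu]_v expR (- 2^-1 * q z v).
  exact: joint_density_residual.
split; [split|].
- exact: measurable_joint_density.
- by move=> z; exact: joint_density_ge0.
- move=> z; rewrite E -[leRHS]mulrA ler_wpM2l ?(ltW gg0)//.
  by apply: Rintegral_prob_le => // v; exact: le_trans (quarter z v).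
- move=> u u' y; rewrite !E -mulrBr normrM (gtr0_norm gg0).
  have -> : gg * lip * expR (ga / 4) * enorm (u - u') *
      (gprofile (al / 4) (u, y) + gprofile (al / 4) (u', y)) =
    gg * (lip * enorm (u - u') * (expR (ga / 4) *
      (gprofile (al / 4) (u, y) + gprofile (al / 4) (u', y)))) by ring.
  rewrite ler_wpM2l ?(ltW gg0)//; apply: Rintegral_prob_dist => // v.
  apply: le_trans (expR_half_sqr_lipschitz (enorm_ge0 _) (enorm_ge0 _)) _.
  apply: ler_pM => //.
  + by apply: le_trans (enorm_lipschitz _ _) _; exact: residual_lipschitz.
  + by rewrite mulrDr lerD//; exact: quarter.
- move=> z; rewrite E -[leLHS]mulrA ler_wpM2l ?(ltW gg0)//.
  apply: Rintegral_prob_ge => // v.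
  have /andP[_ hu] := qbnd z v.
  by rewrite -expRD ler_expR -/(q z v); lra.
Qed.

End DensityEstimates.

(** * The Lipschitz estimate for the analysis map *)

Section Congruence.
Variables (R : realType) (d K : nat).
Local Notation V := 'cV[R]_(d + K).

Lemma cov_eq_on_measurable n (m1 m2 : set 'cV[R]_n -> \bar R) :
  eq_on_measurable m1 m2 -> cov m1 = cov m2.
Proof.
move=> m12.
have me : mean m1 = mean m2.
  by apply/matrixP => i j; rewrite !mxE (eq_on_measurable_integral _ m12).
by apply/matrixP => i j; rewrite [LHS]mxE [RHS]mxE me (eq_on_measurable_integral _ m12).
Qed.

Lemma dg_eq_on_measurable n (m m1 m2 : set 'cV[R]_n -> \bar R) :
  eq_on_measurable m1 m2 -> dg m m1 = dg m m2.
Proof.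
move=> m12; congr ereal_sup; apply/seteqP; split=> _ [f hf <-]; exists f => //;
  by rewrite (eq_on_measurable_integral _ m12).
Qed.

Lemma T_op_eq_on_measurable (ydag : 'cV[R]_K) (m1 m2 : set V -> \bar R) :
  eq_on_measurable m1 m2 -> eq_on_measurable (T_op ydag m1) (T_op ydag m2).
Proof.
move=> m12 A mA; rewrite /T_op /cov_uy /cov_yy (cov_eq_on_measurable m12).
apply: m12; rewrite -[X in measurable X]setTI.
exact: (measurable_affine_map (gain (cov m2)) ydag).
Qed.

End Congruence.

Lemma continuous_measurable_mx (R : realType) m n k l (h : 'M[R]_(m, n) -> 'M[R]_(k, l)) :
  continuous h -> measurable_fun setT h.
Proof.
move=> ch; apply: (@measurability _ _ _ _ _ _ (@open 'M[R]_(k, l))) => //.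
move=> _ [A oA <-]; rewrite setTI; apply: sub_sigma_algebra.
by move/continuousP : ch; apply.
Qed.

Theorem lemma26 (R : realType) (d K : nat) (hd : (1 <= d)%N) (hK : (1 <= K)%N)
    (ky kPsi kh lh : R) (hky : 0 < ky) (hkPsi : 0 < kPsi) (hkh : 0 < kh)
    (hlh : 0 <= lh)
    (Sigma : 'M[R]_d) (Gamma : 'M[R]_K)
    (hSigma : spdmx Sigma) (hGamma : spdmx Gamma)
    (r : R) (hr : 1 <= r) :
  exists L : R,
    forall (J : nat) (hJ : (1 <= J)%N) (ydag : nat -> 'cV[R]_K)
      (Psi : 'cV[R]_d -> 'cV[R]_d) (h : 'cV[R]_d -> 'cV[R]_K),
      (forall j, (1 <= j <= J)%N -> enorm (ydag j) <= ky) ->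
      measurable_fun [set: 'cV[R]_d] Psi ->
      (forall v, enorm (Psi v) <= kPsi) ->
      continuous h ->
      (forall v, enorm (h v) <= kh) ->
      (forall u v, enorm (h u - h v) <= lh * enorm (u - v)) ->
      forall (pi : probability 'cV[R]_(d + K) R)
        (mu : probability 'cV[R]_d R) (j : nat),
        in_PR r pi -> (j < J)%N ->
        let p := Q_op Gamma h (P_op Sigma Psi mu) in
        (dg (T_op (ydag j.+1) pi) (T_op (ydag j.+1) p) <= L%:E * dg pi p)%E.
Proof.
have [a [b [c [C [L [a0 b0 c0 L0 hreg]]]]]] :=
  joint_density_bounds hSigma hGamma (ltW hkPsi) (ltW hkh) hlh.
have [LT hLT] := @dg_T_op_regular_density R d K a b c C L r ky a0 b0 c0 L0 hr (ltW hky).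
exists LT => J hJ ydag Psi h hy mPsi hPsi ch hh hlip pi mu j hpi jJ.
cbv zeta.
have mh := continuous_measurable_mx ch.
have [q [pq hq]] := Q_P_has_density hSigma hGamma mu mPsi mh.
have [reg low] := hreg Psi h mu mPsi mh hPsi hh hlip.
rewrite (dg_eq_on_measurable _ (T_op_eq_on_measurable (ydag j.+1) pq)).
rewrite (dg_eq_on_measurable _ pq).
by apply: hLT reg low hq _ _ hpi _; apply: hy.
Qed.
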